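(* For every integer $n\ge 0$ the associahedron $\mathcal K^n$ admits a triangulation by $(n+1)^{n-1}$ $n$-simplices whose orientation is compatible with the Tamari order on the set of vertices of $\mathcal K^n$. For $n\ge 1$, the $n$-simplices of this triangulation are the cones, with apex the South pole $S$ of $\mathcal K^n$, over the $(n-1)$-simplices determined by the following choices. Choose either (1) an $(n-1)$-simplex of the triangulation of $\mathcal K^{n-1}$, where $\mathcal K^{n-1}$ is identified with the cell $\gamma(1;0,n-1)$ of $\partial\mathcal K^n$; or (2) a cell $\gamma(a;p,q)$ of $\partial \mathcal K^n$ with $p\ge 1$, $q\ge 0$, $p+q=n-1$, $1\le a\le p+1$, which is identified with $\mathcal K^p\times\mathcal K^q$, and in it a $p$-simplex of the triangulation of $\mathcal K^p$, a $q$-simplex of the triangulation of $\mathcal K^q$ and a $(p,q)$-shuffle (these three data determining an $(n-1)$-simplex of $\mathcal K^p\times \mathcal K^q$).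
   Context: Trees and associahedron. $Y_m$ is the set of planar binary rooted trees with $m$ internal vertices ($m+1$ leaves). For $t\in Y_m$, $m\ge1$, number the leaves $0,\dots,m$ from left to right and the internal vertices $1,\dots,m$ so that vertex $i$ lies between leaves $i-1$ and $i$. Let $a_i$ (resp. $b_i$) be the number of leaves that are descendants of vertex $i$ on its left (resp. right) side, and put $M(t)=(a_1b_1,\dots,a_mb_m)\in\mathbb R^m$. The associahedron $\mathcal K^{n}$ is the convex hull of the points $M(t)$, $t\in Y_{n+1}$; it is an $n$-dimensional polytope lying in the hyperplane $x_1+\cdots+x_{n+1}=(n+1)(n+2)/2$ of $\mathbb R^{n+1}$, and its vertices are the $M(t)$, identified with $t\in Y_{n+1}$. $\mathcal K^0$ is a point, with its unique triangulation. Tamari order. It is the partial order on $Y_m$ whose covering relations $t\to t'$ are: $t'$ is obtained from $t$ by replacing locally a subtree of shape $(xy)z$ by $x(yz)$. The maximum is the right comb (every left child is a leaf). The South pole $S$ of $\mathcal K^n$ is the vertex corresponding to the right comb in $Y_{n+1}$, i.e. $S=(n+1,n,\dots,1)$. Cells. Faces of $\mathcal K^n$ are in bijection with planar rooted trees with $n+2$ leaves (every internal vertex having at least two inputs): the face of a tree $T$ has as vertices the binary trees from which $T$ is obtained by contracting internal edges. The facets correspond to trees $\gamma(a;p,q)$ with two internal vertices, where $p,q\ge 0$, $p+q=n-1$, $0\le a\le p+1$: the root has $p+2$ inputs, indexed $0,\dots,p+1$ from right to left; the input of index $a$ carries the second internal vertex, which has $q+2$ leaves, and the other inputs of the root are leaves.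 The cell $\gamma(a;p,q)$ is identified with $\mathcal K^p\times\mathcal K^q$: the vertex $(t,s)\in Y_{p+1}\times Y_{q+1}$ corresponds to the tree obtained by grafting the root of $s$ on the leaf of $t$ of index $a$ (leaves of $t$ counted from right to left starting at $0$). In particular $\gamma(1;0,n-1)$ is identified with $\mathcal K^{n-1}$. Oriented simplices. A simplex is oriented by a total order $v_0,v_1,\dots,v_n$ of its vertices, each edge being directed from the smaller to the larger vertex. The orientation is compatible with the Tamari order if $v_0<v_1<\cdots<v_n$ in the Tamari order. Shuffles and products. A $(p,q)$-shuffle is a permutation written as a word $\theta(1)\theta(2)\cdots\theta(p+q)$ in the letters $1,\dots,p+q$ in which $1,\dots,p$ appear in increasing order and $p+1,\dots,p+q$ appear in increasing order. Given oriented simplices with vertices $v_0,\dots,v_p$ and $w_0,\dots,w_q$, the standard triangulation of their product has its $(p+q)$-simplices indexed by $(p,q)$-shuffles: the simplex of $\theta$ has as successive vertices the points $(v_i,w_j)$ obtained by starting at $(v_0,w_0)$ and, at the $k$th step, increasing $i$ by $1$ if $\theta(k)\le p$ and increasing $j$ by $1$ if $\theta(k)>p$. *)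

(* Defs.v *)
From Stdlib Require Import Relation_Operators.
From mathcomp Require Import all_boot all_order all_fingroup all_algebra.
From mathcomp Require Import boolp classical_sets functions cardinality reals.
From mathcomp Require Import convex.

Set Implicit Arguments.
Unset Strict Implicit.
Unset Printing Implicit Defensive.

Import Order.TTheory GRing.Theory Num.Theory.

Local Open Scope classical_set_scope.
Local Open Scope ring_scope.

Inductive bintree : Type := Leaf | Node of bintree & bintree.

Fixpoint nodes (t : bintree) : nat :=
  if t is Node l r then (nodes l + nodes r).+1 else 0%N.

Fixpoint leaves (t : bintree) : nat :=
  if t is Node l r then (leaves l + leaves r)%N else 1%N.

Definition Y (m : nat) : pred bintree := fun t => nodes t == m.

(* The list of the products a_i * b_i. Listing the internal vertices in
   infix order puts vertex i between leaves i - 1 and i. *)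
Fixpoint weights (t : bintree) : seq nat :=
  if t is Node l r then weights l ++ (leaves l * leaves r)%N :: weights r
  else [::].

(* The point M(t) of R^m, meaningful when t is in Y m. *)
Definition loday (R : realType) (m : nat) (t : bintree) : 'rV[R]_m :=
  \row_(i < m) (nth 0%N (weights t) i)%:R.

Definition hull (R : realType) (V : lmodType R) (A : set V) : set V :=
  smallest (@convex_set R V) A.

Definition associahedron (R : realType) (n : nat) : set 'rV[R]_n.+1 :=
  hull [set loday R n.+1 t | t in [set` Y n.+1]].

Arguments associahedron : clear implicits.

Inductive tamari_cover : bintree -> bintree -> Prop :=
| tamari_rot x y z :
    tamari_cover (Node (Node x y) z) (Node x (Node y z))
| tamari_left l l' r : tamari_cover l l' -> tamari_cover (Node l r) (Node l' r)
| tamari_right l r r' : tamari_cover r r' -> tamari_cover (Node l r) (Node l r').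

Definition tamari_le : bintree -> bintree -> Prop :=
  clos_refl_trans bintree tamari_cover.

Definition tamari_lt (t u : bintree) : Prop := tamari_le t u /\ t <> u.

Fixpoint right_comb (m : nat) : bintree :=
  if m is m'.+1 then Node Leaf (right_comb m') else Leaf.

Definition south_pole (n : nat) : bintree := right_comb n.+1.

(* [graft t a s] grafts the root of s on the leaf of t of index a, the leaves
   of t being indexed from right to left starting at 0. For t in Y p.+1 and s
   in Y q.+1 it is the vertex (t, s) of the cell gamma(a;p,q). Only indices
   a < leaves t are meaningful. *)
Fixpoint graft (t : bintree) (a : nat) (s : bintree) : bintree :=
  if t is Node l r then
    if (a < leaves r)%N then Node l (graft r a s)
    else Node (graft l (a - leaves r)%N s) r
  else s.

(* The word of theta is theta 0, theta 1, ...; letters and positions are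
   shifted by one, so that the letters 1..p become the l < p. The position of
   the letter l is theta^-1 l. *)
Definition is_shuffle (p q : nat) (theta : 'S_(p + q)) : Prop :=
  forall l l' : 'I_(p + q), (l < l')%N -> (l' < p)%N || (p <= l)%N ->
    ((theta^-1)%g l < (theta^-1)%g l')%N.

(* The simplex of theta in the standard triangulation of the product of the
   oriented simplices with vertices v (p.+1 of them) and w (q.+1 of them). *)
Definition product_simplex (p q : nat) (theta : 'S_(p + q))
    (v w : seq bintree) : seq (bintree * bintree) :=
  [seq (nth Leaf v #|[pred l : 'I_(p + q) | (l < k)%N && (theta l < p)%N]|,
        nth Leaf w #|[pred l : 'I_(p + q) | (l < k)%N && (p <= theta l)%N]|)
  | k <- iota 0 (p + q).+1].

(* An oriented simplex of the associahedron is the list, in increasing order,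
   of the trees which are its vertices; [T n] is meant to be the set of
   oriented n-simplices of a triangulation of K^n. *)
Definition boundary_simplices (T : nat -> set (seq bintree)) (n : nat) :
    set (seq bintree) :=
  [set s |
    (exists2 u, T n.-1 u & s = [seq graft (Node Leaf Leaf) 1%N x | x <- u])
    \/
    (exists (p q a : nat) (u v : seq bintree) (theta : 'S_(p + q)),
      [/\ [/\ (1 <= p)%N, (p + q)%N = n.-1 & (1 <= a <= p.+1)%N],
          T p u, T q v, is_shuffle theta &
          s = [seq graft x.1 a x.2 | x <- product_simplex theta u v]])].

Definition tamari_compatible (s : seq bintree) : Prop :=
  forall i j : nat, (i < j < size s)%N ->
    tamari_lt (nth Leaf s i) (nth Leaf s j).

Definition affinely_independent (R : realType) (d : nat)
    (s : seq 'rV[R]_d) : bool :=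
  free [seq x - head 0 s | x <- behead s].

(* D is the set of the vertex lists of the n-simplices. *)
Definition is_triangulation (R : realType) (d n : nat) (P : set 'rV[R]_d)
    (D : set (seq 'rV[R]_d)) : Prop :=
  [/\ finite_set D,
      forall s, D s -> size s = n.+1 /\ affinely_independent s,
      \bigcup_(s in D) hull [set` s] = P &
      forall s s', D s -> D s' ->
        exists f : seq 'rV[R]_d, [/\ {subset f <= s}, {subset f <= s'} &
          hull [set` s] `&` hull [set` s'] = hull [set` f]]].

(* Main.v *)
From Stdlib Require Import Relation_Operators.
Require Import Defs.
From HB Require Import structures.
From mathcomp Require Import all_boot all_order all_fingroup all_algebra.
From mathcomp Require Import boolp classical_sets functions cardinality reals.
From mathcomp Require Import interval_inference convex zify ring lra.

Set Implicit Arguments.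
Unset Strict Implicit.
Unset Printing Implicit Defensive.

Import Order.TTheory GRing.Theory Num.Theory.

Local Open Scope classical_set_scope.
Local Open Scope ring_scope.
Local Open Scope card_scope.

(** The triangulation is the pulling triangulation of the associahedron: a
    simplex is a maximal chain of faces in which each face is a facet of the
    next one avoiding its Tamari-maximal vertex, and its vertices are these
    maxima. Coning from the South pole over the facets that do not contain it
    and recursing produces these chains, because every face is a product of
    associahedra and a staircase in a product of two chains is a chain of the
    product.

    Coordinates. The partial sums of M(t), measured from those of the left
    comb, form the vector [slack] of t, one entry per leaf. The facet functional
    [gap] of an interval of leaves is affine in it, is nonnegative on trees, and
    vanishes exactly when the interval is the set of leaves of a subtree
    ([gap_tree]). Grafting s on a leaf of t turns slack vectors into slack
    vectors of s and t ([slack_plug]), provided the leaf of t receives the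
    weight of all the leaves of s; so a facet of the associahedron is a product
    of associahedra with weighted leaves, not of standard ones, and the
    geometric statements are proved for all positive leaf weights at once.

    The simplices cover ([slack_region_covered]). Follow the ray from the South
    pole through a point until it leaves the polytope. It stops on a facet that
    avoids the South pole ([ray_exit]); the two factors of the exit point are
    covered by induction ([facet_regions]), their barycentric coordinates merge
    along a staircase ([merge_walk]), and the South pole is added back
    ([cone_over_facet]).

    The simplices fit together ([flag_rigid]). Let a point be written as a
    convex combination of the vertices of two chains. The largest vertices with
    nonzero weight lie in each other's face, hence are comparable both ways in
    the Tamari order and coincide; the functional of the next facet on either
    side vanishes on all smaller vertices, so the two weights agree, and the
    vertex can be removed. Thus the point determines the weights. This gives at
    once the affine independence of the vertices of a simplex, the fact that two
    simplices meet along the hull of their common vertices, and the fact that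
    different simplices have different hulls.

    The count. The last two vertices of a simplex determine its facet, and the
    staircase in it determines everything else ([simplex_of_inj]), so the number
    of simplices satisfies the recursion
    a(n+1) = sum over p + q = n of (p+1) C(n, p) a(p) a(q), which Abel's
    binomial identity ([abel]) solves by (n+1)^(n-1). *)

(** * Grafting and subtrees *)

HB.instance Definition _ := gen_eqMixin bintree.
HB.instance Definition _ := gen_choiceMixin bintree.

Lemma leaves_nodes t : leaves t = (nodes t).+1.
Proof. by elim: t => //= l -> r ->; lia. Qed.

Lemma leaves_gt0 t : (0 < leaves t)%N.
Proof. by rewrite leaves_nodes. Qed.

(** Grafting with leaves counted from left to right: the index of the leaf is
    then also the first leaf of the grafted subtree. *)
Fixpoint plug (t : bintree) (i : nat) (s : bintree) : bintree :=
  if t is Node l r then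
    if (i < leaves l)%N then Node (plug l i s) r
    else Node l (plug r (i - leaves l) s)
  else s.

Lemma graft_plug t a s : (a < leaves t)%N ->
  graft t a s = plug t ((leaves t).-1 - a) s.
Proof.
elim: t a => //= l IHl r IHr a ha.
have hl := leaves_gt0 l; have hr := leaves_gt0 r.
case: ltnP => har.
  by rewrite ifF ?IHr //; [congr Node; congr plug; lia | lia].
by rewrite ifT ?IHl; [congr Node; congr plug; lia | lia | lia].
Qed.

Lemma leaves_plug t i s : (i < leaves t)%N ->
  leaves (plug t i s) = (leaves t + (leaves s).-1)%N.
Proof.
elim: t i => [|l IHl r IHr] i /=; first by have := leaves_gt0 s; lia.
move=> hi; case: ltnP => hl /=; first by rewrite IHl //; lia.
by rewrite IHr; lia.
Qed.

Lemma plug_inj i t t' s s' : (i < leaves t)%N ->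
  leaves t = leaves t' -> leaves s = leaves s' ->
  plug t i s = plug t' i s' -> t = t' /\ s = s'.
Proof.
elim: t t' i => [|l IHl r IHr] [|l' r'] i /=; rewrite ?[in (_ = 1)%N]leaves_nodes.
- by [].
- by have := leaves_gt0 l'; have := leaves_gt0 r'; lia.
- by have := leaves_gt0 l; have := leaves_gt0 r; lia.
move=> hi hlr hs; have hs1 := leaves_gt0 s.
case: ltnP => hl; case: ltnP => hl' [] el er.
- have ell : leaves l = leaves l' by have := congr1 leaves er; lia.
  by have [-> ->] := IHl l' i hl ell hs el; rewrite er.
- have := congr1 leaves el; rewrite leaves_plug //.
  lia.
- have := congr1 leaves el; rewrite leaves_plug //.
  lia.
- rewrite -el in er hlr *.
  have hir : (i - leaves l < leaves r)%N by lia.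
  have elr : leaves r = leaves r' by lia.
  by have [-> ->] := IHr r' _ hir elr hs er.
Qed.

(** The intervals of leaves [b, e] cut out by the subtrees with at least two
    leaves. Other than the interval of all leaves, they name the facets of the
    associahedron that contain the tree. *)
Fixpoint block (t : bintree) (b e : nat) : bool :=
  if t is Node l r then
    [|| (b == 0)%N && (e.+1 == leaves l + leaves r)%N,
        (e < leaves l)%N && block l b e
      | (leaves l <= b)%N && block r (b - leaves l) (e - leaves l)]
  else false.

Lemma block_bound t b e : block t b e -> (b < e < leaves t)%N.
Proof.
elim: t b e => //= l IHl r IHr b e.
have hl := leaves_gt0 l; have hr := leaves_gt0 r.
by case/or3P => [/andP[]|/andP[_ /IHl]|/andP[? /IHr]]; lia.
Qed.

Lemma block_plug_in t i s b e : (i < leaves t)%N -> (b < e < leaves s)%N ->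
  block (plug t i s) (i + b) (i + e) = block s b e.
Proof.
elim: t i => [|l IHl r IHr] i hi hbe /=.
  by rewrite /= in hi; congr block; lia.
have hl := leaves_gt0 l; have hr := leaves_gt0 r; rewrite /= in hi.
case: ltnP => hil /=; rewrite leaves_plug; try lia.
  rewrite IHl // (_ : (i + e < _)%N = true); last lia.
  rewrite (_ : (_ <= i + b)%N = false); last lia.
  by rewrite (_ : (_.+1 == _) = false) ?andbF ?orbF //; lia.
rewrite (_ : (i + e < _)%N = false); last lia.
rewrite (_ : (_ == 0)%N = false); last lia.
rewrite (_ : (_ <= i + b)%N = true) /=; last lia.
rewrite -[RHS](IHr (i - leaves l)%N) //; last lia.
by congr block; lia.
Qed.

(** The grafted leaf is replaced by an interval of leaves, which stretches
    every interval containing it and shifts those on its right. *)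
Lemma block_plug_out t i s b e : (i < leaves t)%N -> (b < e < leaves t)%N ->
  block (plug t i s) (if b <= i then b else b + (leaves s).-1)%N
    (if e < i then e else e + (leaves s).-1)%N = block t b e.
Proof.
have hs := leaves_gt0 s.
elim: t i b e => [|l IHl r IHr] i b e /= hi hbe; first lia.
have hl := leaves_gt0 l; have hr := leaves_gt0 r.
case: (ltnP i (leaves l)) => hil /=; rewrite leaves_plug; try lia.
- congr [|| _, _ | _].
  + case: (leqP b i); case: (ltnP e i); lia.
  + case: (ltnP e (leaves l)) => he; last by case: (ltnP e i); lia.
    have -> : ((if (e < i)%N then e else e + (leaves s).-1) <
               leaves l + (leaves s).-1)%N by case: (ltnP e i); lia.
    by rewrite IHl //; lia.
  + case: (leqP (leaves l) b) => hb; last by case: (leqP b i); lia.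
    rewrite (_ : (b <= i)%N = false); last lia.
    rewrite (_ : (e < i)%N = false); last lia.
    rewrite (_ : (_ <= _)%N = true) /=; last lia.
    by congr block; lia.
- congr [|| _, _ | _].
  + case: (leqP b i); case: (ltnP e i); lia.
  + case: (ltnP e (leaves l)) => he; last by case: (ltnP e i); lia.
    have -> : (b <= i)%N by lia.
    have -> : (e < i)%N by lia.
    by rewrite he.
  + case: (leqP (leaves l) b) => hb; last by case: (leqP b i); lia.
    rewrite -[in RHS](IHr (i - leaves l)%N); [|lia|lia].
    have -> : (leaves l <= if (b <= i)%N then b else b + (leaves s).-1)%N.
      by case: (leqP b i); lia.
    have -> : (b - leaves l <= i - leaves l)%N = (b <= i)%N by lia.
    have -> : (e - leaves l < i - leaves l)%N = (e < i)%N by lia.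
    by case: (leqP b i); case: (ltnP e i) => _ _ /=; congr block; lia.
Qed.

Lemma block_root t : (1 < leaves t)%N -> block t 0 (leaves t).-1.
Proof.
case: t => //= l r _; apply/orP; left.
by rewrite prednK // addn_gt0 leaves_gt0.
Qed.

(** A face of the polytope is a product: a tree on the facet of [b, e] splits
    at that subtree. *)
Lemma plug_of_block u b e : block u b e ->
  exists t s, [/\ u = plug t b s, leaves s = (e - b).+1,
     leaves t = (leaves u - (e - b))%N & (b < leaves t)%N].
Proof.
elim: u b e => //= l IHl r IHr b e.
have hl := leaves_gt0 l; have hr := leaves_gt0 r.
case/or3P => [/andP[/eqP-> /eqP he]|/andP[he hb]|/andP[he hb]].
- by exists Leaf, (Node l r); split=> //=; lia.
- have := block_bound hb => hb'.
  case: (IHl _ _ hb) => t [s [-> h1 h2 h3]].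
  have hp := leaves_plug s h3.
  exists (Node t r), s; rewrite /= h3; split => //; lia.
- have := block_bound hb => hb'.
  case: (IHr _ _ hb) => t [s [-> h1 h2 h3]].
  have hp := leaves_plug s h3.
  by exists (Node l t), s; rewrite /= ifF; [split => //; lia|lia].
Qed.

Lemma tamari_refl t : tamari_le t t.
Proof. exact: rt_refl. Qed.

Lemma tamari_trans u t v : tamari_le t u -> tamari_le u v -> tamari_le t v.
Proof. exact: rt_trans. Qed.

Lemma tamari_map (f : bintree -> bintree) t u :
  (forall x y, tamari_cover x y -> tamari_le (f x) (f y)) ->
  tamari_le t u -> tamari_le (f t) (f u).
Proof.
move=> hf; elim=> [x y /hf //|x|x y z _ h1 _ h2]; first exact: tamari_refl.
exact: tamari_trans h1 h2.
Qed.

Lemma tamari_Node l l' r r' : tamari_le l l' -> tamari_le r r' ->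
  tamari_le (Node l r) (Node l' r').
Proof.
move=> hl hr; apply: (@tamari_trans (Node l' r)).
  apply: (tamari_map (f := fun x => Node x r)) hl => x y h.
  by apply: rt_step; apply: tamari_left.
apply: (tamari_map (f := Node l')) hr => x y h.
by apply: rt_step; apply: tamari_right.
Qed.

Lemma tamari_leaves t u : tamari_le t u -> leaves t = leaves u.
Proof.
elim=> [x y|//|x y z _ -> _ -> //].
by elim=> [???|??? _ /= ->|??? _ /= ->] //=; rewrite addnA.
Qed.

Lemma plug_tamari_l t t' i s : tamari_le t t' -> tamari_le (plug t i s) (plug
  t' i s).
Proof.
apply: (tamari_map (f := plug^~ i ^~ s)) => x y h; apply: rt_step.
elim: h i => {x y} [x y z|l l' r h IH|l r r' h IH] i /=.
- have hx := leaves_gt0 x.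
  case: (ltnP i (leaves x)) => h1.
    by rewrite ifT ?h1; [exact: tamari_rot|lia].
  case: (ltnP i (leaves x + leaves y)) => h2.
    rewrite ifT; last lia.
    exact: tamari_rot.
  rewrite ifF; last lia.
  by rewrite subnDA; exact: tamari_rot.
- have := tamari_leaves (rt_step _ _ _ _ h) => ->.
  by case: ltnP => _; [apply: tamari_left|apply: tamari_left].
- by case: ltnP => _; apply: tamari_right.
Qed.

Lemma plug_tamari_r t i s s' : tamari_le s s' -> tamari_le (plug t i s) (plug t
  i s').
Proof.
move=> h; elim: t i => //= l IHl r IHr i.
by case: ltnP => _; apply: tamari_Node => //; exact: tamari_refl.
Qed.

Lemma leaves_comb m : leaves (right_comb m) = m.+1.
Proof. by elim: m => //= m ->. Qed.

Lemma nodes_comb m : nodes (right_comb m) = m.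
Proof. by elim: m => //= m ->. Qed.

Lemma tamari_comb t : tamari_le t (right_comb (nodes t)).
Proof.
have comb2 a b : tamari_le (Node (right_comb a) (right_comb b)) (right_comb (a
  + b).+1).
  elim: a b => [|a IH] b; first exact: tamari_refl.
  apply: tamari_trans (rt_step _ _ _ _ (tamari_rot _ _ _)) _.
  exact: tamari_Node (tamari_refl _) (IH b).
elim: t => [|l IHl r IHr] /=; first exact: tamari_refl.
exact: tamari_trans (tamari_Node IHl IHr) (comb2 _ _).
Qed.

(** Each rotation increases this number, which makes the Tamari order
    antisymmetric and lets chains be recovered from their sets of vertices. *)
Fixpoint rweight (t : bintree) : nat :=
  if t is Node l r then (rweight l + rweight r + leaves r)%N else 0%N.

Lemma tamari_rweight t u : tamari_le t u -> t = u \/ (rweight t < rweight u)%N.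
Proof.
elim=> [x y h|x|x y z _ IH1 _ IH2]; [right|by left|].
  elim: h => {x y} [x y z|l l' r h IH|l r r' h IH] /=; last 1 first.
  - by rewrite (tamari_leaves (rt_step _ _ _ _ h)); lia.
  - by have := leaves_gt0 z; lia.
  - lia.
case: IH1 IH2 => [->|h1] [<-|h2]; [by left|by right|by right|right; lia].
Qed.

Lemma tamari_antisym t u : tamari_le t u -> tamari_le u t -> t = u.
Proof. by move=> /tamari_rweight[//|h] /tamari_rweight[//|]; lia. Qed.

Lemma tamari_lt_rweight t u : tamari_lt t u -> (rweight t < rweight u)%N.
Proof. by case=> /tamari_rweight[]. Qed.

(** * Slack coordinates and facet functionals *)

Section Slack.
Variable R : realFieldType.
Implicit Types (w D : nat -> R) (t s l r : bintree).

(** The function w lists the partial sums of the leaf weights: leaf j has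
    weight w (j + 1) - w j. The point of t has at an internal vertex the
    product of the weights of its two sides, and [slack w t j] is the sum of
    its first j coordinates minus the same sum for the left comb. On a right
    subtree, every left leaf forms an additional product with the leaves
    beyond j. *)
Fixpoint slack w t (j : nat) : R :=
  if t is Node l r then
    if (j < leaves l)%N then slack w l j
    else slack (fun k => w (leaves l + k)%N) r (j - leaves l)
         + (w (leaves l) - w 0%N) * (w (leaves l + leaves r)%N - w j.+1)
  else 0.

Lemma slack_ext w w' t j : (forall k, (k <= leaves t)%N -> w k = w' k) ->
  (j < leaves t)%N -> slack w t j = slack w' t j.
Proof.
elim: t w w' j => //= l IHl r IHr w w' j hw hj.
case: ltnP => hl; first by apply: IHl => // k hk; apply: hw; lia.
rewrite !hw; try lia; congr (_ + _); apply: IHr => [k hk|]; last lia.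
by apply: hw; lia.
Qed.

Lemma slack_first w t : slack w t 0 = 0.
Proof. by elim: t w => //= l IHl r IHr w; rewrite leaves_gt0. Qed.

Lemma slack_last w t : slack w t (leaves t).-1 = 0.
Proof.
elim: t w => //= l IHl r IHr w.
have hl := leaves_gt0 l; have hr := leaves_gt0 r.
rewrite ifF; last lia.
rewrite (_ : (_ - leaves l)%N = (leaves r).-1); last lia.
by rewrite IHr prednK ?subrr ?mulr0 ?addr0 //; lia.
Qed.

(** This is the bound that the facet inequality of the leaves j, ..., m puts
    on the entry j, so the South pole maximizes every entry of the slack
    vector. *)
Lemma slack_comb w m j : (j <= m)%N ->
  slack w (right_comb m) j = (w j - w 0%N) * (w m.+1 - w j.+1).
Proof.
elim: m w j => [|m IH] w j hj /=.
  by rewrite (_ : j = 0)%N ?subrr ?mul0r //; lia.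
case: j hj => [|j] hj /=; first by rewrite subrr mul0r.
by rewrite subn1 /= IH // leaves_comb !add1n; ring.
Qed.

(** The partial sums of the weights after the leaves i, ..., i + d are merged
    into the single leaf i. *)
Definition collapse (i d : nat) w (k : nat) : R :=
  w (if (k <= i)%N then k else k + d)%N.

(** The affine product structure of a facet. Inside the grafted tree, the
    entry k also counts the pairs formed by a leaf on the left of the graft
    and a leaf of s beyond k; this depends on w only. *)
Lemma slack_plug w t i s k : (i < leaves t)%N -> (k < leaves t + (leaves s).-1)%N ->
  slack w (plug t i s) k =
    let d := (leaves s).-1 in let w' := collapse i d w in
    if (k < i)%N then slack w' t k
    else if (k <= i + d)%N then
      slack (fun h => w (i + h)%N) s (k - i) + slack w' t i
      + (w i - w 0%N) * (w (i + d).+1 - w k.+1)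
    else slack w' t (k - d).
Proof.
have hs := leaves_gt0 s; move=> + + /=.
elim: t i w k => [|l IHl r IHr] i w k /= hi hk.
  rewrite (_ : i = 0)%N; last lia.
  rewrite ifT; last lia.
  by rewrite subn0 subrr mul0r !addr0.
have hl := leaves_gt0 l; have hr := leaves_gt0 r.
case: (ltnP i (leaves l)) => hil /=.
  rewrite leaves_plug //; case: ltnP => hkl.
    rewrite IHl //; case: ltnP => hki; first by rewrite ifT //; lia.
    case: leqP => hkd //.
    by rewrite ifT //; lia.
  rewrite ifF; last lia.
  rewrite ifF; last lia.
  rewrite ifF; last lia.
  rewrite /collapse ifF ?ifF ?ifF; try lia.
  rewrite (_ : (k - _ - _)%N = (k - (leaves l + (leaves s).-1))%N); last lia.
    rewrite (_ : ((k - _).+1 + _)%N = k.+1); last lia.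
  congr (_ + (_ - _) * (w _ - _)); last lia.
  apply: slack_ext => [h hh|]; last lia.
  by congr w; case: leqP; lia.
case: (ltnP k (leaves l)) => hkl.
  rewrite ifT; last lia.
  apply: slack_ext => // h hh; rewrite /collapse ifT //; lia.
rewrite IHr; try lia; rewrite leaves_plug; try lia.
have hext j : (j < leaves r)%N ->
    slack (collapse (i - leaves l) (leaves s).-1 (fun h => w (leaves l + h)%N)) r j
    = slack (fun h => collapse i (leaves s).-1 w (leaves l + h)%N) r j.
  by apply: slack_ext => h hh; rewrite /collapse; congr w; (case: leqP => ?;
    case: leqP => ?; lia).
rewrite (_ : (k - leaves l < _)%N = (k < i)%N); last lia.
rewrite (_ : (k - leaves l <= _)%N = (k <= i + (leaves s).-1)%N); last lia.
have hN : collapse i (leaves s).-1 w (leaves l + leaves r)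
    = w (leaves l + (leaves r + (leaves s).-1))%N.
  by rewrite /collapse ifF; [congr w; lia|lia].
have hm : collapse i (leaves s).-1 w (leaves l) = w (leaves l).
  by rewrite /collapse ifT //; lia.
rewrite hN hm.
case: (ltnP k i) => hki.
  by rewrite hext; [rewrite /collapse ifT|lia].
case: (leqP k (i + (leaves s).-1)) => hkd.
  rewrite hext; last lia.
  rewrite (_ : collapse i (leaves s).-1 w i.+1 = w (i + (leaves s).-1).+1);
    last first.
    by rewrite /collapse ifF //; lia.
  rewrite (_ : (leaves l + (i - leaves l) = i)%N); last lia.
  rewrite (_ : (leaves l + (i - leaves l + (leaves s).-1).+1 = (i + (leaves
    s).-1).+1)%N); last lia.
  rewrite (_ : (leaves l + (k - leaves l).+1 = k.+1)%N); last lia.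
  rewrite (_ : (k - leaves l - (i - leaves l) = k - i)%N); last lia.
  rewrite addn0 (_ : slack (fun h => w (leaves l + (i - leaves l + h))%N) s (k - i)
            = slack (fun h => w (i + h)%N) s (k - i));
              first by rewrite /collapse /=; ring.
  by apply: slack_ext => [h hh|]; [congr w; lia|lia].
rewrite ifF; last lia.
rewrite hext; last lia.
rewrite (_ : collapse i (leaves s).-1 w (k - (leaves s).-1).+1 = w k.+1);
  last first.
  by rewrite /collapse ifF; [congr w; lia|lia].
by rewrite (_ : (k - leaves l - _ = k - (leaves s).-1 - leaves l)%N); last lia.
Qed.

(** The facet inequality of the leaves i, ..., j: the coordinates of the
    internal vertices between them sum at least to the sum of the pairwise
    products of the weights of these leaves. *)
Definition gap w D (i j : nat) : R :=
  (w i - w 0%N) * (w j.+1 - w i.+1) - D i + D j.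

(** Two leaves of the interval always meet at a vertex of the interval, so the
    inequality holds, and it is an equality when no other pair of leaves meets
    there, which says that the interval is cut out by a subtree. *)
Lemma gap_tree w t i j : {homo w : a b / (a < b)%N >-> a < b} ->
  (i < j < leaves t)%N ->
  if block t i j then gap w (slack w t) i j = 0 else 0 < gap w (slack w t) i j.
Proof.
move=> + hij.
elim: t w i j hij => [|l IHl r IHr] w i j /= hij hw; first lia.
have hw' : {homo w : a b / (a <= b)%N >-> a <= b}.
  by move=> a b; rewrite leq_eqVlt => /orP[/eqP->//|/hw/ltW].
have hl := leaves_gt0 l; have hr := leaves_gt0 r.
case: (ltnP j (leaves l)) => hjl.
  rewrite (_ : (i == 0)%N && _ = false) /=; last lia.
  rewrite (_ : (leaves l <= i)%N = false) ?orbF; last lia.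
  rewrite /gap /= hjl (_ : (i < leaves l)%N); last lia.
  by apply: IHl => //; lia.
rewrite /gap /= (_ : (j < leaves l)%N = false) /=; last lia.
case: (ltnP i (leaves l)) => hil.
  rewrite orbF.
  have hD : slack w l i <= (w i - w 0%N) * (w (leaves l) - w i.+1).
    case: (ltnP i (leaves l).-1) => hi.
      have hb : (i < (leaves l).-1 < leaves l)%N by lia.
      have := IHl w _ _ hb hw; rewrite /gap slack_last prednK // addr0.
      by case: ifP => _; lra.
    rewrite (_ : i = (leaves l).-1)%N ?slack_last ?prednK ?subrr ?mulr0 //; lia.
  have hDj : 0 <= slack (fun k => w (leaves l + k)%N) r (j - leaves l).
    case: (posnP (j - leaves l)) => [->|hj]; first by rewrite slack_first.
    have hb : (0 < j - leaves l < leaves r)%N by lia.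
    have := IHr (fun k => w (leaves l + k)%N) _ _ hb.
    rewrite /gap slack_first subrr mul0r subr0 add0r => IH.
    suff /IH : {homo (fun k => w (leaves l + k)%N) : a b / (a < b)%N >-> a < b}.
      by case: ifP => _; [move=> ->|move/ltW].
    by move=> a b hab; apply: hw; lia.
  have hpos : 0 <= (w (leaves l) - w 0%N) * (w (leaves l + leaves r)%N - w j.+1).
    by apply: mulr_ge0; rewrite subr_ge0; apply: hw'; lia.
  have hi0 : 0 <= (w i - w 0%N) * (w j.+1 - w (leaves l)).
    by apply: mulr_ge0; rewrite subr_ge0; apply: hw'; lia.
  case: eqP => [i0|/eqP i0] /=.
    rewrite i0 slack_first subrr mul0r subr0 add0r.
    case: eqP => [hjN|/eqP hjN].
      rewrite -hjN subrr mulr0 addr0.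
      rewrite (_ : (j - leaves l)%N = (leaves r).-1) ?slack_last //; lia.
    apply: ltr_wpDl => //.
    by apply: mulr_gt0; rewrite subr_gt0; apply: hw; lia.
  have : 0 < (w i - w 0%N) * (w j.+1 - w (leaves l)).
    by apply: mulr_gt0; rewrite subr_gt0; apply: hw; lia.
  have -> : (w i - w 0%N) * (w j.+1 - w (leaves l)) =
    (w i - w 0%N) * (w j.+1 - w i.+1) - (w i - w 0%N) * (w (leaves l) - w i.+1)
      by ring.
  lra.
rewrite (_ : (i == 0)%N && _ = false) /=; last lia.
have hb : (i - leaves l < j - leaves l < leaves r)%N by lia.
have := IHr (fun k => w (leaves l + k)%N) _ _ hb.
rewrite /gap (_ : (leaves l + (i - leaves l).+1 = i.+1)%N); last lia.
rewrite (_ : (leaves l + (j - leaves l).+1 = j.+1)%N); last lia.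
rewrite addn0 (_ : (leaves l + (i - leaves l) = i)%N); last lia.
set Di := slack _ r _; set Dj := slack _ r _.
rewrite (_ : (_ - w 0%N) * _ - _ + _ =
  (w i - w (leaves l)) * (w j.+1 - w i.+1) - Di + Dj); last by ring.
by apply=> a b hab; apply: hw; lia.
Qed.
End Slack.

(** * Staircases and shuffles *)

(** Step sequences of staircases, listed so that the simplices can be listed
    too. *)
Fixpoint words (n p : nat) : seq (seq bool) :=
  if n is n'.+1 then
    (if p is p'.+1 then map (cons true) (words n' p') else [::])
    ++ map (cons false) (words n' p)
  else if p is 0 then [:: [::]] else [::].

Lemma mem_words n p (w : seq bool) : (w \in words n p) = (size w == n) &&
  (count id w == p).
Proof.
have hcons b s (L : seq (seq bool)) : (b :: s \in map (cons b) L) = (s \in L).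
  by rewrite mem_map // => ? ? [].
have hnot b s (L : seq (seq bool)) : (b :: s \in map (cons (~~ b)) L) = false.
  by apply/mapP => -[x _ [/esym/eqP]]; case: b.
have hnil b (L : seq (seq bool)) : ([::] \in map (cons b) L) = false.
  by apply/mapP => -[].
elim: n p w => [|n IH] p w; first by case: p w => [|p] [|b w].
case: p w => [|p] [|b w] /=; rewrite ?mem_cat ?hnil //.
- by case: b; rewrite ?hcons ?(hnot true) ?IH //= andbF.
- by case: b; rewrite hcons ?(hnot true) ?(hnot false) ?orbF IH //= eqSS.
Qed.

Lemma words_uniq n p : uniq (words n p).
Proof.
elim: n p => [|n IH] [|p] //=; first by rewrite map_inj_uniq // => ? ? [].
rewrite cat_uniq !map_inj_uniq ?IH; try by move=> ? ? [].
rewrite andbT /=; apply/hasPn => _ /mapP[x _ ->].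
by apply/mapP => -[].
Qed.

Lemma size_words n p : size (words n p) = 'C(n, p).
Proof.
elim: n p => [|n IH] [|p] //=; first by rewrite size_map IH !bin0.
by rewrite size_cat !size_map !IH binS addnC.
Qed.

(** A staircase is read from the corner of the two heads; true advances in the
    first list. The lists are meant to be decreasing, so that the head of a
    staircase is the maximum of the product. *)
Fixpoint walk (w : seq bool) (u v : seq bintree) : seq (bintree * bintree) :=
  (head Leaf u, head Leaf v) ::
  if w is b :: w' then
    walk w' (if b then behead u else u) (if b then v else behead v)
  else [::].

Lemma size_walk w u v : size (walk w u v) = (size w).+1.
Proof. by elim: w u v => //= b w IH u v; rewrite IH. Qed.

Lemma walkE w u v : walk w u v =
  [seq (nth Leaf u (count id (take k w)), nth Leaf v (count negb (take k w)))
  | k <- iota 0 (size w).+1].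
Proof.
elim: w u v => [|b w IH] u v; first by rewrite /= !nth0.
have -> : iota 0 (size (b :: w)).+1 = 0%N :: map S (iota 0 (size w).+1).
  by rewrite -(iotaDl 1 0).
rewrite [LHS]/= IH map_cons -map_comp !nth0; congr (_ :: _).
by apply: eq_map => k /=; case: b => /=; rewrite ?add0n ?nth_behead.
Qed.

Lemma nth_walk w u v k : (k <= size w)%N -> nth (Leaf, Leaf) (walk w u v) k =
  (nth Leaf u (count id (take k w)), nth Leaf v (count negb (take k w))).
Proof.
by move=> hk; rewrite walkE (nth_map 0%N) ?size_iota // nth_iota.
Qed.

Lemma rev_walk w u v :
  (count id w).+1 = size u -> (count negb w).+1 = size v ->
  rev (walk w u v) = walk (rev w) (rev u) (rev v).
Proof.
move=> hu hv; apply: (@eq_from_nth _ (Leaf, Leaf)) => [|k].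
  by rewrite size_rev !size_walk size_rev.
rewrite size_rev size_walk => hk.
rewrite nth_rev ?size_walk // !nth_walk ?size_rev ?subSS; try lia.
have hcat (a : pred bool) : count a w =
    (count a (take (size w - k) w) + count a (drop (size w - k) w))%N.
  by rewrite -count_cat cat_take_drop.
have hc (a : pred bool) : count a (take k (rev w)) =
    (count a w - count a (take (size w - k) w))%N.
  by rewrite take_rev count_rev hcat addKn.
have hle (a : pred bool) : (count a (take (size w - k) w) <= count a w)%N.
  by rewrite [X in (_ <= X)%N]hcat leq_addr.
have := hle id; have := hle negb => h1 h2.
rewrite !hc !nth_rev; try lia.
by congr (nth _ _ _, nth _ _ _); lia.
Qed.

Section Shuffles.
Variables p q : nat.
Implicit Type theta : 'S_(p + q).

Definition shuffle_word theta : seq bool :=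
  [seq (theta l < p)%N | l <- enum 'I_(p + q)].

Lemma card_ord_lt n (a : pred 'I_n) k :
  #|[pred l : 'I_n | (l < k)%N && a l]| = count id (take k (map a (enum 'I_n))).
Proof.
rewrite -map_take count_map cardE size_filter -enumT.
rewrite -[in LHS](cat_take_drop k (enum 'I_n)) count_cat [X in (_ + X)%N](_ : _
  = 0%N).
  rewrite addn0; apply: eq_in_count => l.
  by rewrite in_take ?mem_enum // index_enum_ord => hl /=; rewrite inE hl.
apply/eqP; rewrite -leqn0 leqNgt -has_count; apply/hasPn => l hl.
have := enum_uniq 'I_n; rewrite -{1}(cat_take_drop k (enum 'I_n)) cat_uniq.
case/and3P=> _ /hasPn/(_ _ hl) + _.
by rewrite in_take ?mem_enum // index_enum_ord => /negbTE h;
  rewrite -[mem _ _]/((l < k)%N && a l) h.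
Qed.

Lemma product_simplexE theta u v :
  product_simplex theta u v = walk (shuffle_word theta) u v.
Proof.
rewrite walkE size_map size_enum_ord /product_simplex; apply: eq_map => k.
rewrite !card_ord_lt; congr (_, nth _ _ _).
rewrite -!map_take !count_map; apply: eq_count => l /=.
by rewrite -leqNgt.
Qed.

Lemma shuffle_word_in theta : shuffle_word theta \in words (p + q) p.
Proof.
rewrite mem_words size_map size_enum_ord eqxx /=.
have -> : count id (shuffle_word theta) = #|[pred l | (theta l < p)%N]|.
  by rewrite count_map cardE size_filter -enumT.
rewrite -sum1_card (reindex_inj (@perm_inj _ theta^-1%g)).
under eq_bigl do rewrite inE permKV.
by rewrite -(big_ord_widen _ (fun=> 1%N) (leq_addr q p)) sum1_card card_ord.
Qed.

Lemma count_negb (w : seq bool) : count negb w = (size w - count id w)%N.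
Proof. by rewrite -(count_predC id w) addKn; apply: eq_count. Qed.

Lemma count_take (a : pred bool) (w : seq bool) i j : (i <= j)%N ->
  (count a (take i w) <= count a (take j w))%N.
Proof.
move=> hij; rewrite -(cat_take_drop i (take j w)) take_takel // count_cat.
exact: leq_addr.
Qed.

Lemma count_take_lt (a : pred bool) (w : seq bool) i : (i < size w)%N ->
  a (nth false w i) -> (count a (take i w) < count a w)%N.
Proof.
move=> hi ha; rewrite -[in X in (_ < X)%N](cat_take_drop i.+1 w) count_cat.
by rewrite (take_nth false) // -cats1 count_cat /= ha; lia.
Qed.

(** A shuffle sends the true positions to 0, 1, ..., p - 1 and the false ones
    to p, ..., p + q - 1, in increasing order. *)
Lemma shuffle_word_surj (w : seq bool) : w \in words (p + q) p ->
  exists2 theta, is_shuffle theta & shuffle_word theta = w.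
Proof.
rewrite mem_words => /andP[/eqP sw /eqP cw].
have cw' : count negb w = q by rewrite count_negb sw cw addKn.
pose f (l : nat) := if nth false w l then count id (take l w)
               else (p + count negb (take l w))%N.
have hf (l : 'I_(p + q)) : (f l < p + q)%N /\ (f l < p)%N = nth false w l.
  rewrite /f; have hl : (l < size w)%N by rewrite sw.
  case: (boolP (nth false w l)) => hw.
    by have := @count_take_lt id w l hl hw; rewrite cw => h; split => //;
      exact: ltn_addr.
  by have := @count_take_lt negb w l hl hw; rewrite cw' => h;
    rewrite ltn_add2l [(_ + _ < p)%N]ltnNge leq_addr.
have hmono (i j : 'I_(p + q)) : (i < j)%N -> nth false w i = nth false w j ->
    (f i < f j)%N.
  move=> hij hw; rewrite /f -hw.
  have hi : (i < size w)%N by rewrite sw.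
  have ht (a : pred bool) : a (nth false w i) -> (count a (take i w) < count a
    (take j w))%N.
    move=> ha; have := count_take a w hij; apply: leq_trans.
    by rewrite (take_nth false) // -cats1 count_cat /= ha addn1.
  by case: ifP => hwi; [|rewrite ltn_add2l]; apply: ht; rewrite hwi.
have finj : injective (fun l : 'I_(p + q) => Ordinal (hf l).1).
  move=> i j /(congr1 val) /= eij; apply: val_inj => /=.
  have hw : nth false w i = nth false w j by rewrite -(hf i).2 -(hf j).2 eij.
  case: (ltngtP i j) => // h; first by have := hmono _ _ h hw; rewrite eij ltnn.
  by have := hmono _ _ h (esym hw); rewrite eij ltnn.
pose theta : 'S_(p + q) := perm finj.
have thetaE l : theta l = f l :> nat by rewrite permE.
exists theta => [l l' hl hp|].
  set a := theta^-1%g l; set b := theta^-1%g l'.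
  have ha : l = f a :> nat by rewrite -thetaE permKV.
  have hb : l' = f b :> nat by rewrite -thetaE permKV.
  have hw : nth false w b = nth false w a by rewrite -(hf a).2 -(hf b).2 -ha
    -hb; lia.
  case: (ltngtP a b) => // h; first by have := hmono _ _ h hw; lia.
  by have := congr1 f h; lia.
apply: (@eq_from_nth _ false) => [|i]; rewrite size_map size_enum_ord // => hi.
rewrite (nth_map (Ordinal hi)) ?size_enum_ord // thetaE.
by rewrite (hf _).2 nth_enum_ord.
Qed.

End Shuffles.

Lemma walk_sub w (u v : seq bintree) z : (count id w < size u)%N -> (count negb
  w < size v)%N ->
  z \in walk w u v -> z.1 \in u /\ z.2 \in v.
Proof.
elim: w u v => [|b w IH] [|x u] [|y v] //= hu hv; rewrite inE.
  by move/eqP => -> /=; rewrite !mem_head.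
case/predU1P => [->|]; first by rewrite !mem_head.
case: b hu hv => /= hu hv hz.
  by have [|//|h1 h2] := IH u (y :: v) _ _ hz; rewrite ?inE ?h1 ?orbT //; lia.
by have [//||h1 h2] := IH (x :: u) v _ _ hz; rewrite ?inE ?h2 ?orbT //; lia.
Qed.

(** A staircase determines the chains it was built from, as each coordinate
    repeats a vertex only on consecutive steps. *)
Lemma undup_walk1 w (u v : seq bintree) : (count id w).+1 = size u -> uniq u ->
  undup (map fst (walk w u v)) = u.
Proof.
elim: w u v => [|b w IH] [|x u] v //=; first by case: u.
case: b => /= hc /andP[hx hu].
  by rewrite -mem_undup IH //= ?(negbTE hx) //; lia.
have E := IH (x :: u) (behead v) hc; rewrite /= hx hu in E.
by rewrite -mem_undup E //= mem_head.
Qed.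

Lemma undup_walk2 w (u v : seq bintree) : (count negb w).+1 = size v -> uniq v ->
  undup (map snd (walk w u v)) = v.
Proof.
elim: w u v => [|b w IH] u [|y v] //=; first by case: v.
case: b => /= hc /andP[hy hv]; last first.
  by rewrite -mem_undup IH //= ?(negbTE hy) //; lia.
have E := IH (behead u) (y :: v) hc; rewrite /= hy hv in E.
by rewrite -mem_undup E //= mem_head.
Qed.

Lemma walk_word_inj w w' (u v : seq bintree) : (count id w).+1 = size u ->
  (count id w').+1 = size u -> uniq u -> walk w u v = walk w' u v -> w = w'.
Proof.
elim: w w' u v => [|b w IH] [|b' w'] [|x u] v //=.
- by move=> _ _ _ [/(congr1 size)]; rewrite size_walk.
- by move=> _ _ _ [/(congr1 size)]; rewrite size_walk.
have hd w0 u0 v0 : head (Leaf, Leaf) (walk w0 u0 v0) = (head Leaf u0, head Leaf v0).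
  by case: w0.
move=> h h' /andP[hx hu] [] E.
have := congr1 (head (Leaf, Leaf)) E; rewrite !hd => -[E1 _].
case: b b' h h' E E1 => [] [] /=; rewrite ?add1n ?add0n => h h' E E1.
- by congr (_ :: _); apply: IH E => //; lia.
- by case: u hx hu h h' E E1 => //= y u hx _ _ _ _ E1; rewrite E1 mem_head in hx.
- by case: u hx hu h h' E E1 => //= y u hx _ _ _ _ E1; rewrite E1 mem_head in hx.
- by congr (_ :: _); apply: IH E => //=; rewrite hx.
Qed.

Section Weighted.
Variable R : realFieldType.

(** Lists of pairs of a coefficient and a vertex serve as finite measures;
    [wsum] integrates against them. *)
Definition wsum (T : Type) (a : seq (R * T)) (F : T -> R) : R :=
  \sum_(z <- a) z.1 * F z.2.

Lemma wsum_cons (T : Type) c x (a : seq (R * T)) F :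
  wsum ((c, x) :: a) F = c * F x + wsum a F.
Proof. by rewrite /wsum big_cons. Qed.

Lemma wsum_nil (T : Type) (F : T -> R) : wsum [::] F = 0.
Proof. by rewrite /wsum big_nil. Qed.

Definition nonneg (T : Type) (a : seq (R * T)) := all (fun z => 0 <= z.1) a.

Lemma wsum_ge0 (T : Type) (a : seq (R * T)) F : nonneg a -> (forall x, 0 <= F x) ->
  0 <= wsum a F.
Proof.
move=> + hF; elim: a => [|[c x] a IH]; first by rewrite wsum_nil.
by case/andP => /= hc /IH ha; rewrite wsum_cons addr_ge0 // mulr_ge0.
Qed.

(** Convex combinations of two chains are the marginals of one along a
    staircase: always spend the smaller of the two head coefficients on the
    pair of heads, and advance in the list where it came from. Equality of the
    total masses ensures that neither list runs out early. *)
Lemma merge_walk (a b : seq (R * bintree)) : nonneg a -> nonneg b ->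
  (0 < size a)%N -> (0 < size b)%N ->
  wsum a (fun=> 1) = wsum b (fun=> 1) ->
  exists w (ab : seq (R * (bintree * bintree))),
    [/\ w \in words ((size a).-1 + (size b).-1) (size a).-1,
        map snd ab = walk w (map snd a) (map snd b), nonneg ab,
        forall F, wsum ab (fun z => F z.1) = wsum a F &
        forall F, wsum ab (fun z => F z.2) = wsum b F].
Proof.
have [n] := ubnP (size a + size b).
elim: n a b => // n IH [//|[c x] a] [//|[d y] b] /= hn /andP[/= hc ha] /andP[/=
  hd hb] _ _.
rewrite !wsum_cons !mulr1 => hm.
have stepT : (0 < size a)%N -> c <= d -> exists w (ab : seq (R * (bintree *
  bintree))),
    [/\ w \in words (size a + size b) (size a),
        map snd ab = walk w (x :: map snd a) (y :: map snd b), nonneg ab,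
        forall F, wsum ab (fun z => F z.1) = wsum ((c, x) :: a) F &
        forall F, wsum ab (fun z => F z.2) = wsum ((d, y) :: b) F].
  move=> sa hcd; have [||||||w [ab [hw hs hab h1 h2]]] := IH a ((d - c, y) :: b).
  - by rewrite /=; lia.
  - by [].
  - by rewrite /nonneg /= subr_ge0 hcd.
  - by [].
  - by [].
  - by rewrite wsum_cons mulr1; lra.
  exists (true :: w), ((c, (x, y)) :: ab); split => [|/=||F|F].
  - by move: hw; rewrite !mem_words /=; lia.
  - by rewrite hs.
  - by rewrite /nonneg /= hc.
  - by rewrite !wsum_cons /= h1.
  - by rewrite !wsum_cons /= h2 wsum_cons; ring.
have stepF : (0 < size b)%N -> d <= c -> exists w (ab : seq (R * (bintree *
  bintree))),
    [/\ w \in words (size a + size b) (size a),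
        map snd ab = walk w (x :: map snd a) (y :: map snd b), nonneg ab,
        forall F, wsum ab (fun z => F z.1) = wsum ((c, x) :: a) F &
        forall F, wsum ab (fun z => F z.2) = wsum ((d, y) :: b) F].
  move=> sb hcd; have [||||||w [ab [hw hs hab h1 h2]]] := IH ((c - d, x) :: a) b.
  - by rewrite /=; lia.
  - by rewrite /nonneg /= subr_ge0 hcd.
  - by [].
  - by [].
  - by [].
  - by rewrite wsum_cons mulr1; lra.
  exists (false :: w), ((d, (x, y)) :: ab); split => [|/=||F|F].
  - by move: hw; rewrite !mem_words /=; lia.
  - by rewrite hs.
  - by rewrite /nonneg /= hd.
  - by rewrite !wsum_cons /= h1 wsum_cons; ring.
  - by rewrite !wsum_cons /= h2.
have ma := wsum_ge0 ha (fun=> ler01); have mb := wsum_ge0 hb (fun=> ler01).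
case: a b hn ha hb hm ma mb stepT stepF => [|z a] [|z' b] /= hn ha hb hm ma mb
  stepT stepF.
- move: hm; rewrite !wsum_nil !addr0 => <-.
  exists [::], [:: (c, (x, y))]; split => // [|F|F].
  + by rewrite /nonneg /= hc.
  + by rewrite !wsum_cons !wsum_nil.
  + by rewrite !wsum_cons !wsum_nil.
- by apply: stepF => //; move: hm; rewrite wsum_nil; lra.
- by apply: stepT => //; move: hm; rewrite wsum_nil; lra.
- by case: (lerP c d) => [/stepT|/ltW/stepF]; apply.
Qed.

End Weighted.

(** * Chains of faces and the recursive list of simplices *)

(** The trees with m internal vertices whose subtrees include all the
    intervals of J form a face, and v is its Tamari maximum. *)
Definition ismax m (J : seq (nat * nat)) v :=
  [/\ nodes v = m, forall k : nat * nat, k \in J -> block v k.1 k.2 &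
      forall u, nodes u = m -> (forall k : nat * nat, k \in J -> block u k.1 k.2) ->
        tamari_le u v].

(** A decreasing list of the maxima of faces, each face being cut out of the
    preceding one by a facet k avoiding its maximum. The list J accumulates
    the facets used so far. *)
Inductive flag m : seq (nat * nat) -> seq bintree -> Prop :=
| flag1 J v : ismax m J v -> flag m J [:: v]
| flagS J v k s : ismax m J v -> ~~ block v k.1 k.2 -> flag m (k :: J) s ->
    flag m J (v :: s).

Lemma ismax_ext m J J' v : J =i J' -> ismax m J v -> ismax m J' v.
Proof.
move=> e [h1 h2 h3]; split=> // [k|u hu hk]; first by rewrite -e; apply: h2.
by apply: h3 => // k; rewrite e; apply: hk.
Qed.

Lemma flag_ext m J J' s : J =i J' -> flag m J s -> flag m J' s.
Proof.
move=> e h; elim: h J' e => {J s} [J v h|J v k s h hk _ IH] J' e.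
  exact/flag1/(ismax_ext e).
apply: flagS (ismax_ext e h) hk _; apply: IH => z.
by rewrite !inE e.
Qed.

Lemma flag_inv m J v s : flag m J (v :: s) -> ismax m J v /\
  (s = [::] \/ exists2 k, ~~ block v k.1 k.2 & flag m (k :: J) s).
Proof.
move E: (v :: s) => s' h; case: h E => {J s'} [J v' h [-> ->]|J v' k s' h hk hs
  [-> ->]].
  by split; [|left].
by split; [|right; exists k].
Qed.

Lemma flag_all m J s v : flag m J s -> v \in s ->
  nodes v = m /\ forall k : nat * nat, k \in J -> block v k.1 k.2.
Proof.
elim=> {J s} [J x [h1 h2 _]|J x k s [h1 h2 _] _ _ IH];
  first by rewrite inE => /eqP ->.
rewrite inE => /predU1P[->//|/IH[h h']]; split=> // z hz.
by apply: h'; rewrite inE hz orbT.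
Qed.

Lemma flag_lt m J v s x : flag m J (v :: s) -> x \in s -> tamari_lt x v.
Proof.
case/flag_inv=> -[h1 h2 h3] [-> //|[k hk hs hx]].
have [h4 h5] := flag_all hs hx; split.
  by apply: h3 => // z hz; apply: h5; rewrite inE hz orbT.
by move=> e; rewrite -e h5 ?mem_head in hk.
Qed.

Lemma flag_neq0 m J s : flag m J s -> (0 < size s)%N.
Proof. by case. Qed.

Lemma flag_pairwise m J s : flag m J s -> pairwise (fun x y => rweight y <
  rweight x)%N s.
Proof.
elim=> {J s} [//|J v k s h1 h2 h3 IH] /=; rewrite IH andbT.
by apply/allP => x hx; apply: tamari_lt_rweight; apply: (flag_lt (flagS h1 h2 h3)).
Qed.

Lemma flag_uniq m J s : flag m J s -> uniq s.
Proof.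
by move/flag_pairwise; apply: pairwise_uniq => x; rewrite ltnn.
Qed.

Lemma flag_bound m J k s : flag m (k :: J) s -> (k.1 < k.2 < m.+1)%N.
Proof.
case: s => [/flag_neq0//|v s] /flag_all /(_ (mem_head _ _))[h /(_ k (mem_head _
  _))].
by move/block_bound; rewrite leaves_nodes h.
Qed.

(** Intervals of leaves of s and of t, seen in the tree obtained by grafting s
    on the leaf i of t. *)
Definition lift_in (i : nat) (k : nat * nat) := (i + k.1, i + k.2)%N.
Definition lift_out (i d : nat) (k : nat * nat) :=
  ((if k.1 <= i then k.1 else k.1 + d), (if k.2 < i then k.2 else k.2 + d))%N.

Definition cell_flag i d (J1 J2 : seq (nat * nat)) : seq (nat * nat) :=
  (i, i + d)%N :: map (lift_out i d) J1 ++ map (lift_in i) J2.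

(** The maximum of a product of faces is the pair of the maxima, as the Tamari
    order on a facet contains the product order. *)
Lemma ismax_plug p q i J1 J2 x y : (i < p.+2)%N ->
  ismax p.+1 J1 x -> ismax q.+1 J2 y ->
  ismax (p + q).+2 (cell_flag i q.+1 J1 J2) (plug x i y).
Proof.
move=> hi [hx1 hx2 hx3] [hy1 hy2 hy3].
have lx : leaves x = p.+2 by rewrite leaves_nodes hx1.
have ly : leaves y = q.+2 by rewrite leaves_nodes hy1.
have hix : (i < leaves x)%N by rewrite lx.
have leq t : nodes t = (leaves t).-1 by rewrite leaves_nodes.
split=> [|k|u hu hk].
- by rewrite leq leaves_plug // lx ly; lia.
- rewrite /cell_flag inE mem_cat => /predU1P[->|/orP[/mapP[z hz ->]|/mapP[z hz
    ->]]] /=.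
  + rewrite -[X in block _ X _]addn0 block_plug_in ?ly ?ltnSn //.
    by have := @block_root y; rewrite ly; apply.
  + have := block_bound (hx2 _ hz) => hb.
    by have := block_plug_out y hix hb; rewrite ly => ->; apply: hx2.
  + have := block_bound (hy2 _ hz) => hb.
    by rewrite block_plug_in //; apply: hy2.
have := plug_of_block (hk _ (mem_head _ _)) => /= -[t [s [eu ls lt hit]]].
rewrite addKn in ls lt; have lu : leaves u = (p + q).+3 by rewrite leaves_nodes hu.
have nt : nodes t = p.+1 by rewrite leq lt lu; lia.
have ns : nodes s = q.+1 by rewrite leq ls.
rewrite eu; apply: tamari_trans (plug_tamari_r _ _ _) (plug_tamari_l _ _ _).
  apply: hy3 => // z hz; have := block_bound (hy2 _ hz) => hb.
  rewrite -(block_plug_in hit) ?ls -?ly // -eu.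
  by apply: (hk (lift_in i z)); rewrite /cell_flag inE mem_cat map_f ?orbT.
apply: hx3 => // z hz; have := block_bound (hx2 _ hz) => hb.
rewrite -(block_plug_out s hit); last by rewrite leaves_nodes nt -lx.
rewrite ls -eu; apply: (hk (lift_out i q.+1 z)).
by rewrite /cell_flag inE mem_cat map_f ?orbT.
Qed.

Lemma cell_flag_out i d k J1 J2 :
  cell_flag i d (k :: J1) J2 =i lift_out i d k :: cell_flag i d J1 J2.
Proof. by move=> z; rewrite !inE orbCA. Qed.

Lemma cell_flag_in i d k J1 J2 :
  cell_flag i d J1 (k :: J2) =i lift_in i k :: cell_flag i d J1 J2.
Proof. by move=> z; rewrite !(inE, mem_cat) [in LHS](orbCA (_ \in map _ J1))
  orbCA. Qed.

(** A step of the staircase in one coordinate leaves the other alone, so the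
    facet that this step crosses is the lift of the facet crossed in the chain
    of that coordinate. *)
Lemma flag_walk p q i J1 J2 u v w : (i < p.+2)%N ->
  flag p.+1 J1 u -> flag q.+1 J2 v ->
  (count id w).+1 = size u -> (count negb w).+1 = size v ->
  flag (p + q).+2 (cell_flag i q.+1 J1 J2) [seq plug z.1 i z.2 | z <- walk w u v].
Proof.
move=> hi; elim: w u v J1 J2 => [|b w IH] u v J1 J2 hu hv;
  case: u hu (flag_neq0 hu) => // x u hu _;
    case: v hv (flag_neq0 hv) => // y v hv _.
  move=> [/esym/size0nil su] [/esym/size0nil sv].
  have [hx _] := flag_inv hu; have [hy _] := flag_inv hv; rewrite su sv.
  exact: flag1 (ismax_plug hi hx hy).
have [hx hu'] := flag_inv hu; have [hy hv'] := flag_inv hv.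
have lx : leaves x = p.+2 by rewrite leaves_nodes; case: hx => ->.
have ly : leaves y = q.+2 by rewrite leaves_nodes; case: hy => ->.
have hm := ismax_plug hi hx hy.
have hix : (i < leaves x)%N by rewrite lx.
case: b => /= hcu hcv.
- case: hu' => [u0|[k hk fu]]; first by rewrite u0 /= in hcu; lia.
  apply: (flagS (k := lift_out i q.+1 k)) => //.
    have hb := flag_bound fu.
    by have := @block_plug_out x i y k.1 k.2 hix; rewrite lx ly => ->.
  apply: flag_ext (cell_flag_out _ _ _ _ _) _.
  by apply: IH fu hv _ hcv; case: hcu.
- case: hv' => [v0|[k hk fv]]; first by rewrite v0 /= in hcv; lia.
  apply: (flagS (k := lift_in i k)) => //.
    have hb := flag_bound fv.
    by rewrite block_plug_in // ly.
  apply: flag_ext (cell_flag_in _ _ _ _ _) _.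
  by apply: IH hu fv hcu _; case: hcv.
Qed.

(** The facets through the South pole are the intervals ending at the last
    leaf. *)
Lemma block_comb m b e : block (right_comb m) b e -> e = m.
Proof.
elim: m b e => //= m IH b e; have := leaves_comb m => hl.
case/or3P => [/andP[_ /eqP]|/andP[_ //]|/andP[h1 h2]]; first lia.
by have := IH _ _ h2; have := block_bound h2; lia.
Qed.

Lemma ismax_comb m : ismax m [::] (right_comb m).
Proof. by split=> [|//|u <- _]; [exact: nodes_comb|exact: tamari_comb]. Qed.

Notation simplex_datum := (nat * (nat * (seq bintree * (seq bintree * seq
  bool))))%type.

(** The data (p, (i, (u, (v, w)))): the cell with factors of dimensions p and
    n - p grafted on the leaf i of the first one, decreasing lists u and v of
    the vertices of a simplex in each factor, and a staircase w. The bound i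
    <= p excludes the last leaf, that is, the cells through the South pole.
    For p = 0 this is the cell of the first kind, which carries only one
    staircase. *)
Definition simplex_data (X : nat -> seq (seq bintree)) n : seq simplex_datum :=
  [seq (p, d) | p <- iota 0 n.+1,
    d <- [seq (i, z) | i <- iota 0 p.+1,
           z <- [seq (u, z) | u <- X p,
                 z <- [seq (v, w) | v <- X (n - p)%N, w <- words n p]]]].

Definition simplex_of n (d : simplex_datum) : seq bintree :=
  let: (p, (i, (u, (v, w)))) := d in
  right_comb n.+2 :: [seq plug z.1 i z.2 | z <- walk w u v].

(** Structural recursion on a bound n, since the simplices of dimension n + 1
    need those of all smaller dimensions. *)
Fixpoint simplices_upto n : nat -> seq (seq bintree) :=
  if n is n'.+1 then fun k =>
    if (k <= n')%N then simplices_upto n' k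
    else map (simplex_of n') (simplex_data (simplices_upto n') n')
  else fun=> [:: [:: Node Leaf Leaf]].

Definition simplices n := simplices_upto n n.

Lemma simplices_uptoE n k : (k <= n)%N -> simplices_upto n k = simplices k.
Proof.
elim: n => [|n IH]; first by rewrite leqn0 => /eqP ->.
rewrite leq_eqVlt => /predU1P[-> //|hk] /=.
by rewrite ifT ?IH.
Qed.

Lemma simplicesS n : simplices n.+1 = map (simplex_of n) (simplex_data simplices n).
Proof.
rewrite /simplices /= ltnn /simplex_data; congr map.
congr flatten; apply/eq_in_map => p; rewrite mem_iota => hp.
by rewrite !simplices_uptoE //; lia.
Qed.

Lemma mem_pairs (S T : eqType) (s : seq S) (t : S -> seq T) x y :
  ((x, y) \in [seq (a, b) | a <- s, b <- t a]) = (x \in s) && (y \in t x).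
Proof.
apply/allpairsPdep/andP => [[a [b [ha hb [-> ->]]]]//|[hx hy]].
by exists x, y.
Qed.

Lemma mem_simplex_data X n p i u v w :
  ((p, (i, (u, (v, w)))) \in simplex_data X n) =
  [&& (p <= n)%N, (i <= p)%N, u \in X p, v \in X (n - p)%N & w \in words n p].
Proof.
by rewrite !mem_pairs !mem_iota /= !add0n !ltnS.
Qed.

Lemma flag_simplices n (s : seq bintree) : s \in simplices n -> flag n.+1 [::]
  s /\ size s = n.+1.
Proof.
have [m] := ubnP n; elim: m n s => // m IH [|n] s hn.
  by rewrite inE => /eqP ->; split=> //; apply: flag1; exact: (ismax_comb 1).
rewrite simplicesS => /mapP[[p [i [u [v w]]]]].
rewrite mem_simplex_data => /and5P[hp hi hu hv hw] -> /=.
have [fu su] := IH _ _ (ltac:(lia) : (p < m)%N) hu.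
have [fv sv] := IH _ _ (ltac:(lia) : (n - p < m)%N) hv.
move: hw; rewrite mem_words => /andP[/eqP sw /eqP cw].
have cw' : count negb w = (n - p)%N by rewrite count_negb sw cw.
rewrite size_map size_walk sw; split=> //.
apply: (flagS (k := (i, i + (n - p).+1)%N)); first exact: ismax_comb.
  by apply/negP => h; have := @block_comb n.+2 _ _ h => /=; lia.
have -> : n.+2 = (p + (n - p)).+2 by lia.
have hi' : (i < p.+2)%N by lia.
by apply: (flag_walk hi' fu fv); rewrite ?cw ?cw'.
Qed.

(** * Uniqueness of barycentric coordinates *)

Section Measure.
Variable R : realFieldType.
Implicit Types a b : seq (R * bintree).

Lemma wsum0 (T : Type) (a : seq (R * T)) (F : T -> R) : nonneg a -> wsum a
  (fun=> 1) = 0 ->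
  wsum a F = 0.
Proof.
elim: a => [|[c x] a IH]; first by rewrite !wsum_nil.
case/andP => /= hc ha; rewrite !wsum_cons mulr1 => h.
have ha0 := wsum_ge0 ha (fun=> ler01).
rewrite IH //; last lra.
by rewrite (_ : c = 0) ?mul0r ?addr0 //; lra.
Qed.

Lemma eq_wsum (T : eqType) (a : seq (R * T)) (F G : T -> R) :
  {in map snd a, F =1 G} -> wsum a F = wsum a G.
Proof.
move=> h; rewrite /wsum big_seq [RHS]big_seq; apply: eq_bigr => z hz.
by rewrite h // map_f.
Qed.

Lemma wsum_gap a w i j :
  wsum a (fun t => gap w (slack w t) i j) =
  (w i - w 0%N) * (w j.+1 - w i.+1) * wsum a (fun=> 1)
  - wsum a (fun t => slack w t i) + wsum a (fun t => slack w t j).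
Proof.
elim: a => [|[c x] a IH]; first by rewrite !wsum_nil; ring.
by rewrite !wsum_cons IH /gap; ring.
Qed.

Section Rigid.
Variables (w : nat -> R) (w_incr : {homo w : i j / (i < j)%N >-> i < j}) (m : nat).

(** Equal mass and equal integrals of all slack coordinates: the two measures
    have the same barycenter. *)
Definition same_moments a b := wsum a (fun=> 1) = wsum b (fun=> 1) /\
  forall j, (j <= m)%N -> wsum a (slack w ^~ j) = wsum b (slack w ^~ j).

Lemma gap_ge0 t i j : (i < j < leaves t)%N -> 0 <= gap w (slack w t) i j.
Proof.
by move=> h; have := gap_tree w_incr h; case: ifP => _ => [->|/ltW].
Qed.

Lemma same_moments_gap a b i j : (i < j <= m)%N -> same_moments a b ->
  wsum a (fun t => gap w (slack w t) i j) = wsum b (fun t => gap w (slack w t) i j).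
Proof. by move=> h [h0 h1]; rewrite !wsum_gap h0 !h1 //; lia. Qed.

Lemma wsum_gap_face s (k : nat * nat) J a : flag m J s -> k \in J -> map snd a
  = s ->
  wsum a (fun t => gap w (slack w t) k.1 k.2) = 0.
Proof.
move=> hs hk ea; rewrite (@eq_wsum _ a _ (fun=> 0)).
  by rewrite /wsum big1 // => z _; rewrite mulr0.
move=> x; rewrite ea => hx; have [hm hJ] := flag_all hs hx.
by have hb := hJ _ hk; have := gap_tree w_incr (block_bound hb); rewrite hb.
Qed.

(** The facet functionals of J' integrate to 0 against b, hence against the
    other measure; being nonnegative, they vanish wherever it has positive
    mass. *)
Lemma top_in_face J J' v s x (c : R) a b : flag m J (v :: s) -> flag m J' x ->
  map snd a = s -> map snd b = x -> 0 < c -> nonneg a ->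
  same_moments ((c, v) :: a) b -> forall k : nat * nat, k \in J' -> block v k.1 k.2.
Proof.
move=> hv hx ea eb hc ha hab k hk; apply: contraT => nb.
case: x hx eb => [/flag_neq0 //|y x] hx eb.
have [hy hJ] := flag_all hx (mem_head _ _).
have := block_bound (hJ _ hk); rewrite leaves_nodes hy ltnS => hb.
have := same_moments_gap hb hab; rewrite (wsum_gap_face hx hk eb) wsum_cons.
have [hvm _] := flag_all hv (mem_head _ _).
have hbv : (k.1 < k.2 < leaves v)%N by rewrite leaves_nodes hvm ltnS.
have := gap_tree w_incr hbv; rewrite (negbTE nb) => hg.
have h1 : 0 < c * gap w (slack w v) k.1 k.2 by rewrite mulr_gt0.
suff h2 : 0 <= wsum a (fun t => gap w (slack w t) k.1 k.2) by lra.
rewrite (@eq_wsum _ a _ (fun t => `|gap w (slack w t) k.1 k.2|)) ?wsum_ge0 //.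
move=> z; rewrite ea => hz.
have [|hzm _] := flag_all hv (_ : z \in v :: s); first by rewrite inE hz orbT.
by rewrite ger0_norm // gap_ge0 // leaves_nodes hzm ltnS.
Qed.

(** The facet functional separating v from the rest of its chain sees on the
    left only the mass of v, and on the right at least the mass of v. *)
Lemma top_weight J J' v s s' (c d : R) a b : flag m J (v :: s) -> flag m J' (v
  :: s') ->
  map snd a = s -> map snd b = s' -> nonneg b ->
  same_moments ((c, v) :: a) ((d, v) :: b) -> d <= c.
Proof.
move=> hv hv' ea eb hb hab; have hb0 := wsum_ge0 hb (fun=> ler01).
have [_ [s0|[k hk hs]]] := flag_inv hv.
  have := hab.1; rewrite !wsum_cons !mulr1.
  by move: ea; rewrite s0; case: (a) => // _; rewrite wsum_nil; lra.
have := flag_bound hs; rewrite ltnS => hkb.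
have := same_moments_gap hkb hab.
rewrite !wsum_cons (wsum_gap_face hs (mem_head _ _) ea) addr0.
have [hvm _] := flag_all hv (mem_head _ _).
have hbv : (k.1 < k.2 < leaves v)%N by rewrite leaves_nodes hvm ltnS.
have := gap_tree w_incr hbv; rewrite (negbTE hk) => hg h.
suff h2 : 0 <= wsum b (fun t => gap w (slack w t) k.1 k.2).
  by rewrite -(ler_pM2r hg); lra.
rewrite (@eq_wsum _ b _ (fun t => `|gap w (slack w t) k.1 k.2|)) ?wsum_ge0 //.
move=> z; rewrite eb => hz.
have [|hzm _] := flag_all hv' (_ : z \in v :: s'); first by rewrite inE hz orbT.
by rewrite ger0_norm // gap_ge0 // leaves_nodes hzm ltnS.
Qed.

Lemma same_moments_sym a b : same_moments a b -> same_moments b a.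
Proof. by case=> h1 h2; split=> // j hj; rewrite h2. Qed.

Definition flag0 J s := s = [::] \/ flag m J s.

Lemma flag0_behead J v s : flag m J (v :: s) -> exists J', flag0 J' s.
Proof.
by case/flag_inv=> _ [->|[k _ h]]; [exists [::]; left|exists (k :: J); right].
Qed.

Lemma same_moments_drop0 v a b : same_moments ((0, v) :: a) b -> same_moments a b.
Proof.
by case=> h1 h2; split=> [|j hj]; [move: h1|move: (h2 j hj)];
  rewrite wsum_cons mul0r add0r.
Qed.

(** A barycenter determines the measure on a chain of faces: the heads of the
    two chains with positive mass belong to each other's face, so they are
    equal, and then have equal masses and can be removed. *)
Lemma flag_rigid J J' (s s' : seq bintree) a b : flag0 J s -> flag0 J' s' ->
  map snd a = s -> map snd b = s' -> nonneg a -> nonneg b ->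
  same_moments a b -> forall F, wsum a F = wsum b F.
Proof.
have [n] := ubnP (size a + size b).
elim: n J J' s s' a b => // n IH J J' s s' a b hn hs hs' ea eb ha hb hab F.
case: a ea ha hab hn => [|[c v] a] ea ha hab hn.
  by rewrite wsum_nil (wsum0 _ hb) //; case: hab => <-; rewrite wsum_nil.
case: b eb hb hab hn => [|[d v'] b] eb hb hab hn.
  by rewrite [RHS]wsum_nil (wsum0 _ ha) //; case: hab => ->; rewrite wsum_nil.
case: hs => [s0|hs]; first by rewrite s0 in ea.
case: hs' => [s0|hs']; first by rewrite s0 in eb.
subst s s'; rewrite /= in hs hs'.
have [K hK] := flag0_behead hs; have [K' hK'] := flag0_behead hs'.
have /andP[/= hc ha'] : (0 <= (c, v).1) && nonneg a := ha.
have /andP[/= hd hb'] : (0 <= (d, v').1) && nonneg b := hb; rewrite /= in hn.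
have [c0|c0] := eqVneq c 0.
  rewrite c0 in hab *; rewrite wsum_cons mul0r add0r.
  apply: (IH K J' _ _ a ((d, v') :: b) _ hK (or_intror hs') erefl erefl ha' hb)
    => //.
  exact: same_moments_drop0 hab.
have [d0|d0] := eqVneq d 0.
  rewrite d0 in hab *; rewrite [RHS]wsum_cons mul0r add0r.
  apply: (IH J K' _ _ ((c, v) :: a) b _ (or_intror hs) hK' erefl erefl ha hb')
    => //.
    by rewrite addnS ltnS in hn.
  exact/same_moments_sym/(same_moments_drop0 (same_moments_sym hab)).
have {}hc : 0 < c by rewrite lt_def c0.
have {}hd : 0 < d by rewrite lt_def d0.
have ev : v = v'.
  have [[v1 v2 v3] _] := flag_inv hs; have [[v1' v2' v3'] _] := flag_inv hs'.
  apply: tamari_antisym.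
    by apply: v3' => //; apply: (top_in_face (b := (d, v') :: b) hs hs' erefl
      erefl hc ha' hab).
  by apply: v3 => //; apply: (top_in_face (b := (c, v) :: a) hs' hs erefl erefl
    hd hb' (same_moments_sym hab)).
subst v'; have ecd : c = d.
  apply/eqP; rewrite eq_le (top_weight hs hs' erefl erefl hb' hab) // andbT.
  by rewrite (top_weight hs' hs erefl erefl ha' (same_moments_sym hab)).
subst d; rewrite !wsum_cons; congr (_ + _).
have hn' : (size a + size b < n)%N by move: hn; rewrite addSn addnS !ltnS;
  exact: ltnW.
apply: (IH K K' _ _ a b hn' hK hK' erefl erefl ha' hb').
case: hab => h1 h2; split=> [|j hj].
  by move: h1; rewrite !wsum_cons => /addrI.
by move: (h2 j hj); rewrite !wsum_cons => /addrI.
Qed.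

End Rigid.
End Measure.

Lemma simplices_top n s : s \in simplices n -> exists s', s = right_comb n.+1 :: s'.
Proof.
case: n => [|n]; first by rewrite inE => /eqP ->; exists [::].
rewrite simplicesS => /mapP[[p [i [u [v w]]]] _ ->]; by eexists.
Qed.

Lemma plug_combS m i s :
  plug (right_comb m.+1) i.+1 s = Node Leaf (plug (right_comb m) i s).
Proof. by rewrite /= subn1. Qed.

(** The maximum of a cell avoiding the South pole is a right comb with one
    left child that is not a leaf; its position and size identify the cell. *)
Lemma plug_comb_inj p p' q q' i i' : (i <= p)%N -> (i' <= p')%N ->
  plug (right_comb p.+1) i (right_comb q.+1) =
  plug (right_comb p'.+1) i' (right_comb q'.+1) -> (p + q = p' + q')%N ->
  p = p' /\ i = i'.
Proof.
elim: i p i' p' => [|i IH] p [|i'] p' hi hi'; rewrite ?plug_combS //.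
  by case=> _ /(congr1 leaves); rewrite !leaves_comb; lia.
case: p p' hi hi' => [//|p] [//|p'] hi hi' [] h hpq.
by have [-> ->] : p = p' /\ i = i' by apply: IH => //; lia.
Qed.

Lemma simplex_of_inj n : {in simplex_data simplices n &, injective (simplex_of n)}.
Proof.
move=> [p [i [u [v w]]]] [p' [i' [u' [v' w']]]].
rewrite !mem_simplex_data => /and5P[hp hi hu hv hw] /and5P[hp' hi' hu' hv' hw'].
have flu := flag_simplices hu; have flv := flag_simplices hv.
have flu' := flag_simplices hu'; have flv' := flag_simplices hv'.
rewrite /simplex_of => -[] E.
have [u1 eu] := simplices_top hu; have [v1 ev] := simplices_top hv.
have [u1' eu'] := simplices_top hu'; have [v1' ev'] := simplices_top hv'.
have [ep ei] : p = p' /\ i = i'.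
  apply: (@plug_comb_inj _ _ (n - p) (n - p')) => //; last lia.
  move: E; rewrite eu ev eu' ev'; case: (w) => [|? ?]; case: (w') => [|? ?] [] //.
subst p' i'.
move: hw hw'; rewrite !mem_words => /andP[/eqP sw /eqP cw] /andP[/eqP sw' /eqP cw'].
have nw : count negb w = (n - p)%N by rewrite count_negb sw cw.
have nw' : count negb w' = (n - p)%N by rewrite count_negb sw' cw'.
have hsz (t s : seq bintree) (x : seq bool) :
    flag p.+1 [::] t /\ size t = p.+1 -> flag (n - p).+1 [::] s /\ size s = (n
      - p).+1 ->
    count id x = p -> count negb x = (n - p)%N ->
    all [in [pred z : bintree * bintree |
      (leaves z.1 == p.+2) && (leaves z.2 == (n - p).+2)]] (walk x t s).
  move=> [ft st] [fs ss] cx nx; apply/allP => z hz; rewrite inE !leaves_nodes.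
  have [] := walk_sub _ _ hz; rewrite ?cx ?nx ?st ?ss //.
  by move=> /(flag_all ft)[-> _] /(flag_all fs)[-> _]; rewrite !eqxx.
have {}E : walk w u v = walk w' u' v'.
  apply: inj_in_map E; try exact: hsz.
  move=> [t s] [t' s'] /andP[/= /eqP lt /eqP ls] /andP[/= /eqP lt' /eqP ls'] e.
  by have [|||-> ->] := plug_inj _ _ _ e; rewrite ?lt ?lt' ?ls //; lia.
have eu2 : u = u'.
  rewrite -(@undup_walk1 w u v) ?cw ?flu.2 ?(flag_uniq flu.1) // E.
  by rewrite undup_walk1 ?cw' ?flu'.2 ?(flag_uniq flu'.1).
have ev2 : v = v'.
  rewrite -(@undup_walk2 w u v) ?nw ?flv.2 ?(flag_uniq flv.1) // E.
  by rewrite undup_walk2 ?nw' ?flv'.2 ?(flag_uniq flv'.1).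
rewrite -eu2 -ev2 in E *; rewrite (walk_word_inj _ _ _ E) ?cw ?cw' ?flu.2 //.
exact: flag_uniq flu.1.
Qed.

(** * Counting the simplices *)

Section Abel.
Variable R : comNzRingType.
Implicit Types (f : nat -> R) (x : R).

Definition alt_sum m f := \sum_(k < m.+1) (-1) ^+ k * 'C(m, k)%:R * f k.

(** Alternating binomial sums are iterated differences. *)
Lemma alt_sumS m f : alt_sum m.+1 f = alt_sum m f - alt_sum m (fun k => f k.+1).
Proof.
have -> : alt_sum m f = \sum_(k < m.+2) (-1) ^+ k * 'C(m, k)%:R * f k.
  by rewrite big_ord_recr /= bin_small // mulr0 mul0r addr0.
rewrite /alt_sum big_ord_recl [in RHS]big_ord_recl /= !bin0 -addrA; congr (_ + _).
rewrite -sumrB; apply: eq_bigr => k _.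
by rewrite /bump /= add1n binS natrD exprS; ring.
Qed.

(** The m-th difference of a polynomial of degree less than m is 0. *)
Lemma alt_sum_exp m d x : (d < m)%N -> alt_sum m (fun k => (x + k%:R) ^+ d) = 0.
Proof.
elim: m d => // m IH d hd; rewrite alt_sumS /alt_sum -sumrB.
have hS k : (x + k.+1%:R) ^+ d - (x + k%:R) ^+ d =
    \sum_(e < d) (x + k%:R) ^+ e *+ 'C(d, e).
  rewrite -natr1 addrA [x + _ + 1]addrC exprDn big_ord_recr /= subnn binn.
  rewrite expr0 mul1r mulr1n addrK; apply: eq_bigr => e _.
  by rewrite expr1n mul1r.
rewrite (eq_bigr (fun k : 'I_m.+1 => - \sum_(e < d)
   ((-1) ^+ k * 'C(m, k)%:R * (x + k%:R) ^+ e) *+ 'C(d, e))); last first.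
  move=> k _; rewrite -mulrBr -opprB hS mulrN mulr_sumr; congr (- _).
  by apply: eq_bigr => e _; rewrite [LHS]mulrnAr.
rewrite sumrN exchange_big big1 ?oppr0 // => e _.
have he : (e < m)%N by have := ltn_ord e; lia.
by have := IH e he; rewrite /alt_sum sumrMnl => ->; rewrite mul0rn.
Qed.

End Abel.

Lemma trinomial n k j : (k + j <= n)%N ->
  ('C(n, k) * 'C(n - k, j) = 'C(n, j) * 'C(n - j, k))%N.
Proof.
move=> h; have hn := bin_fact (_ : k <= n)%N.
apply/eqP; rewrite -(eqn_pmul2r (_ : 0 < k`! * (j`! * (n - k - j)`!))%N);
  last first.
  by rewrite !muln_gt0 !fact_gt0.
have e1 := @bin_fact n k (ltac:(lia)); have e2 := @bin_fact (n - k) j (ltac:(lia)).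
have e3 := @bin_fact n j (ltac:(lia)); have e4 := @bin_fact (n - j) k (ltac:(lia)).
rewrite (_ : n - j - k = n - k - j)%N in e4; last lia.
apply/eqP; transitivity n`!; first by rewrite -e1 -e2; ring.
by rewrite -e3 -e4; ring.
Qed.

(** Abel's identity. Writing n - k + 1 = (n + 2) - (k + 1) and expanding in
    powers of n + 2, the coefficient of (n + 2)^j is an (n - j)-th difference
    of a polynomial of degree n - j - 1; only j = n survives. *)
Lemma abel n :
  (\sum_(k < n.+1) 'C(n, k) * (k.+1 ^ k.-1 * (n - k).+1 ^ (n - k)) = n.+2 ^ n)%N.
Proof.
apply/eqP; rewrite -(eqr_nat int) natr_sum natrX; apply/eqP.
pose z : int := n.+2%:R.
pose F (k j : nat) : int := (-1) ^+ (n - k - j) * 'C(n, k)%:R * 'C(n - k, j)%:R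
  * k.+1%:R ^+ (k.-1 + (n - k - j)).
transitivity (\sum_(k < n.+1) \sum_(j < n.+1) z ^+ j * F k j).
  apply: eq_bigr => -[k /= hk] _.
  rewrite 2!natrM !natrX (_ : (n - k).+1%:R = - k.+1%:R + z); last first.
    rewrite /z (_ : n.+2 = k.+1 + (n - k).+1)%N ?natrD ?addKr //; lia.
  rewrite exprDn (big_ord_widen n.+1 (fun j => (- k.+1%:R) ^+ (n - k - j) * z
    ^+ j *+ 'C(n - k, j))); last lia.
  rewrite big_mkcond !mulr_sumr; apply: eq_bigr => j _.
  case: ltnP => hj; last by rewrite /F (@bin_small (n - k)) // !(mulr0, mul0r).
  by rewrite /F exprD -[- k.+1%:R]mulN1r exprMn -mulr_natr; ring.
rewrite exchange_big big_ord_recr /= big1 => [|[j /= hj] _].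
  rewrite add0r -mulr_sumr big_ord_recl big1 => [|i _].
    by rewrite addr0 /F /= subn0 subnn bin0 binn addn0 !expr0 !mulr1.
  rewrite /F /= (@bin_small (n - _)) ?mulr0 ?mul0r // /bump /=.
  have := ltn_ord i; lia.
rewrite -mulr_sumr; apply/eqP; rewrite mulf_eq0; apply/orP; right; apply/eqP.
have hm : ((n - j).+1 <= n.+1)%N by rewrite ltnS leq_subr.
pose G (k : nat) : int := (-1) ^+ k * 'C(n - j, k)%:R * (1 + k%:R) ^+ (n - j).-1.
transitivity (\sum_(k < n.+1) (-1) ^+ (n - j) * 'C(n, j)%:R * (if (k < (n -
  j).+1)%N then G k else 0)).
  apply: eq_bigr => -[k /= hk] _; case: ltnP => hkj; last first.
    by rewrite /F (@bin_small (n - k)) ?mulr0 ?mul0r //; lia.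
  have hb : 'C(n, k)%:R * 'C(n - k, j)%:R = 'C(n, j)%:R * 'C(n - j, k)%:R :> int.
    by rewrite -!natrM trinomial //; lia.
  rewrite /F -[_ * 'C(n, k)%:R * _]mulrA hb /G nat1r.
  have -> : (-1) ^+ (n - j) = (-1) ^+ (n - k - j) * (-1) ^+ k :> int.
    by rewrite -exprD; congr (_ ^+ _); lia.
  have -> : k.+1%:R ^+ (k.-1 + (n - k - j)) = k.+1%:R ^+ (n - j).-1 :> int.
    case: (k) hkj hk => [|k'] hkj hk; first by rewrite !expr1n.
    by congr (_ ^+ _); lia.
  have := sqrr_sign int k; rewrite expr2 => hs.
  rewrite -[LHS]mul1r -{1}hs; ring.
rewrite -mulr_sumr -big_mkcond /= -(big_ord_widen _ G hm).
rewrite [X in _ * X](alt_sum_exp (m := n - j)) ?mulr0 //; lia.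
Qed.

Lemma pairs_uniq (S T : eqType) (s : seq S) (t : S -> seq T) :
  uniq s -> (forall x, uniq (t x)) -> uniq [seq (x, y) | x <- s, y <- t x].
Proof.
move=> hs ht; apply: allpairs_uniq_dep => //.
by move=> [x y] [x' y'] _ _ /= [-> ->].
Qed.

Lemma simplices_uniq n : uniq (simplices n).
Proof.
have [m] := ubnP n; elim: m n => // m IH [|n] hn //.
rewrite simplicesS map_inj_in_uniq; last exact: simplex_of_inj.
have hX k : (k <= n)%N -> uniq (simplices k) by move=> hk; apply: IH; lia.
apply: allpairs_uniq_dep; first exact: iota_uniq.
  move=> p; rewrite mem_iota add0n => /andP[_ hp].
  apply: pairs_uniq => [|_]; first exact: iota_uniq.
  apply: pairs_uniq => [|_]; first by apply: hX; lia.
  apply: pairs_uniq => [|_]; first by apply: hX; lia.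
  exact: words_uniq.
by move=> [x y] [x' y'] _ _ /= [-> ->].
Qed.

Lemma size_simplices n : size (simplices n) = (n.+1 ^ n.-1)%N.
Proof.
have [m] := ubnP n; elim: m n => // m IH [|n] hn //.
rewrite simplicesS size_map size_allpairs_dep sumnE big_map.
rewrite -[iota _ _]/(index_iota 0 n.+1) big_mkord -abel.
rewrite (eq_bigr (fun p : 'I_n.+1 =>
    (p.+1 * (p.+1 ^ p.-1 * ((n - p).+1 ^ (n - p).-1 * 'C(n, p))))%N)); last first.
  move=> p _; have hp := ltn_ord p.
  by rewrite !size_allpairs size_iota size_words !IH //; lia.
rewrite (reindex_inj rev_ord_inj) /=; apply: eq_bigr => -[p /= hp] _.
rewrite subSS (_ : n - (n - p) = p)%N; last lia.
rewrite -bin_sub; last lia.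
rewrite (_ : n - (n - p) = p)%N; last lia.
have -> : ((n - p).+1 ^ (n - p) = (n - p).+1 * (n - p).+1 ^ (n - p).-1)%N.
  by case: (n - p)%N => // d; rewrite -expnS.
ring.
Qed.

(** * Every point lies in a simplex *)

Section Cover.
Variable R : realFieldType.

Lemma wsumD (T : Type) (a : seq (R * T)) F G :
  wsum a (fun x => F x + G x) = wsum a F + wsum a G.
Proof. by rewrite /wsum -big_split; apply: eq_bigr => z _; rewrite mulrDr. Qed.

Lemma wsum_cst (T : Type) (a : seq (R * T)) x :
  wsum a (fun=> x) = x * wsum a (fun=> 1).
Proof. by rewrite /wsum mulr_sumr; apply: eq_bigr => z _; rewrite mulr1 mulrC. Qed.

Lemma wsum_map (T U : Type) (f : T -> U) (a : seq (R * T)) F :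
  wsum [seq (z.1, f z.2) | z <- a] F = wsum a (fun x => F (f x)).
Proof. by rewrite /wsum big_map. Qed.

(** The polytope cut out by the facet inequalities, scaled by c. Scaling
    avoids dividing by the mass left after a vertex is split off. *)
Definition slack_region n (w D : nat -> R) c := [/\ D 0%N = 0, D n.+1 = 0 &
  forall i j, (i < j <= n.+1)%N ->
    D i - D j <= c * ((w i - w 0%N) * (w j.+1 - w i.+1))].

Definition carried n w c D (a : seq (R * bintree)) :=
  [/\ nonneg a, wsum a (fun=> 1) = c, map snd a \in simplices n &
      forall j, (j <= n.+1)%N -> wsum a (slack w ^~ j) = D j].

Lemma homo_collapse i d (w : nat -> R) : {homo w : a b / (a < b)%N >-> a < b} ->
  {homo collapse i d w : a b / (a < b)%N >-> a < b}.
Proof.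
by move=> hw a b hab; apply: hw; case: (leqP a i); case: (leqP b i); lia.
Qed.

(** Subtract from D as large a multiple m of the South pole as the facet
    inequalities allow. The facet functionals of the intervals ending at the
    last leaf vanish at the South pole and impose nothing; the smallest
    quotient over the other intervals is m, and the minimizing interval
    becomes tight. *)
Lemma ray_exit n w D c : {homo w : a b / (a < b)%N >-> a < b} ->
  slack_region n.+1 w D c ->
  exists m i j, [/\ 0 <= m <= c, (i < j <= n.+1)%N,
    slack_region n.+1 w (fun k => D k - m * ((w k - w 0%N) * (w n.+3 - w
      k.+1))) (c - m) &
    D i - m * ((w i - w 0%N) * (w n.+3 - w i.+1)) -
    (D j - m * ((w j - w 0%N) * (w n.+3 - w j.+1)))
     = (c - m) * ((w i - w 0%N) * (w j.+1 - w i.+1))].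
Proof.
move=> hw [D0 D1 hD].
pose gS i j := (w j - w i) * (w n.+3 - w j.+1).
pose gD i j := c * ((w i - w 0%N) * (w j.+1 - w i.+1)) - D i + D j.
have gS0 i j : (i < j <= n.+1)%N -> 0 < gS i j.
  move=> h; rewrite /gS; apply: mulr_gt0; rewrite subr_gt0; apply: hw; lia.
have gD0 i j : (i < j <= n.+2)%N -> 0 <= gD i j.
  by move=> /hD; rewrite /gD; lra.
pose I := ('I_n.+2 * 'I_n.+2)%type.
pose z0 : I := (ord0, ord_max).
pose P (z : I) := (z.1 < z.2)%N.
have hz0 : P z0 by [].
case: (arg_minP (fun z : 'I_n.+2 * 'I_n.+2 => gD z.1 z.2 / gS z.1 z.2) hz0).
move=> [[i hi] [j hj]]; rewrite /P /= => hij hmin.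
set m := gD i j / gS i j.
have hij' : (i < j <= n.+1)%N by lia.
have hm a b : (a < b <= n.+1)%N -> m * gS a b <= gD a b.
  move=> hab; rewrite -ler_pdivlMr ?gS0 //.
  have ha : (a < n.+2)%N by lia.
  have hb : (b < n.+2)%N by lia.
  by apply: (hmin (Ordinal ha, Ordinal hb)) => /=; case/andP: hab.
have gSE a b : gS a b = (w a - w 0%N) * (w b.+1 - w a.+1)
   - (w a - w 0%N) * (w n.+3 - w a.+1) + (w b - w 0%N) * (w n.+3 - w b.+1).
  by rewrite /gS; ring.
have m0 : 0 <= m by apply: divr_ge0; [apply: gD0; lia|apply/ltW/gS0; lia].
(* The interval of the leaves 0 and 1 already bounds the quotient by c. *)
have mc : m <= c.
  have h1 : m * gS 0%N 1%N <= gD 0%N 1%N by apply: hm.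
  have h2 := hD 1%N n.+2 (ltac:(lia)).
  have h3 : 0 < gS 0%N 1%N by apply: gS0.
  rewrite -(ler_pM2r h3); move: h1 h2; rewrite /gD /gS D0 D1; lra.
exists m, i, j; split=> //; first by rewrite m0.
  split=> [||a b hab]; first by rewrite D0; ring.
    by rewrite D1; ring.
  case: (leqP b n.+1) => hb.
    have := hm a b (ltac:(lia)); rewrite gSE /gD; lra.
  have eb : b = n.+2 by lia.
  rewrite eb D1; have := hD a n.+2 (ltac:(lia)); rewrite D1; lra.
have : m * gS i j = gD i j by rewrite /m divfK // gt_eqF // gS0.
rewrite gSE /gD; lra.
Qed.

(** Both factors of a point of a facet satisfy their own facet inequalities.
    An interval of the first factor that starts at the merged leaf is handled
    by combining the inequality of the stretched interval with the tight
    equality. *)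
Lemma facet_regions p q i w E e : {homo w : a b / (a < b)%N >-> a < b} ->
  (i <= p)%N -> slack_region (p + q).+1 w E e ->
  E i - E (i + q.+1)%N = e * ((w i - w 0%N) * (w (i + q.+1).+1 - w i.+1)) ->
  slack_region p (collapse i q.+1 w) (fun k => E (if k < i then k else k +
    q.+1)%N) e /\
  slack_region q (fun k => w (i + k)%N)
    (fun k => E (i + k)%N - E (i + q.+1)%N
              - e * ((w i - w 0%N) * (w (i + q.+1).+1 - w (i + k).+1))) e.
Proof.
move=> hw hip [E0 E1 hE] tight; split; split; rewrite /collapse.
- case: (posnP i) => [i0|//]; move: tight.
  by rewrite i0 E0 subrr mul0r mulr0 !add0n; lra.
- rewrite ifF; last lia.
  by rewrite (_ : p.+1 + q.+1 = (p + q).+2)%N //; lia.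
- move=> a b hab; rewrite leq0n; case: (ltngtP a i) => hai; last 1 first.
  + rewrite hai (_ : (b < i)%N = false) /=; last lia.
    have := hE i (b + q.+1)%N (ltac:(lia)); move: tight.
    rewrite !addSn; lra.
  + case: (ltnP b i) => hbi; first by apply: hE; lia.
    by apply: hE; lia.
  + rewrite (_ : (b < i)%N = false) /=; last lia.
    by rewrite !addSn; apply: hE; lia.
- by rewrite addn0; lra.
- ring.
- move=> a b hab; have := hE (i + a)%N (i + b)%N (ltac:(lia)).
  rewrite !addnS addn0; lra.
Qed.

(** Combinations in the two factors merge along a staircase, and the South
    pole enters with the mass m. *)
Lemma cone_over_facet p q i w m e E1 E2 a1 a2 : (i <= p)%N -> 0 <= m ->
  carried p (collapse i q.+1 w) e E1 a1 -> carried q (fun k => w (i + k)%N) e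
    E2 a2 ->
  exists a, carried (p + q).+1 w (m + e) (fun k =>
    m * ((w k - w 0%N) * (w (p + q).+3 - w k.+1)) +
    if (k < i)%N then E1 k else
    if (k <= i + q.+1)%N then E2 (k - i)%N + E1 i
       + e * ((w i - w 0%N) * (w (i + q.+1).+1 - w k.+1))
    else E1 (k - q.+1)%N) a.
Proof.
move=> hip m0 [a1n a1m a1s a1D] [a2n a2m a2s a2D].
have [fa1 sa1] := flag_simplices a1s; have [fa2 sa2] := flag_simplices a2s.
rewrite size_map in sa1; rewrite size_map in sa2.
have [|||||x [ab [hx hs hab m1 m2]]] := @merge_walk _ a1 a2 => //;
  rewrite ?sa1 ?sa2 ?a1m ?a2m //.
rewrite sa1 sa2 /= in hx.
exists ((m, right_comb (p + q).+2) :: [seq (z.1, plug z.2.1 i z.2.2) | z <-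
  ab]); split.
- by rewrite /nonneg /= m0 all_map; apply: sub_all hab => z; exact.
- by rewrite wsum_cons (wsum_map (fun y => plug y.1 i y.2)) mulr1 (m1 (fun=>
    1)) a1m.
- rewrite simplicesS; apply/mapP.
  exists (p, (i, (map snd a1, (map snd a2, x)))).
    by rewrite mem_simplex_data a1s addKn a2s leq_addr hip hx.
  by rewrite /simplex_of map_cons -hs -!map_comp.
move=> k hk; rewrite wsum_cons (wsum_map (fun y => plug y.1 i y.2)) slack_comb //.
have hz (z : bintree * bintree) : z \in map snd ab ->
    leaves z.1 = p.+2 /\ leaves z.2 = q.+2.
  move: hx; rewrite hs mem_words => /andP[/eqP sx /eqP cx].
  have nx : count negb x = q by rewrite count_negb sx cx addKn.
  move=> /walk_sub; rewrite !size_map cx nx sa1 sa2 => /(_ (leqnn _) (leqnn _)).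
  by rewrite !leaves_nodes => -[/(flag_all fa1)[-> _] /(flag_all fa2)[-> _]].
clear hx hs a1s a2s fa1 fa2 sa1 sa2 a1n a2n hab.
have hP z : z \in map snd ab -> slack w (plug z.1 i z.2) k =
    if (k < i)%N then slack (collapse i q.+1 w) z.1 k else
    if (k <= i + q.+1)%N then
      slack (fun h => w (i + h)%N) z.2 (k - i) + slack (collapse i q.+1 w) z.1 i
       + (w i - w 0%N) * (w (i + q.+1).+1 - w k.+1)
    else slack (collapse i q.+1 w) z.1 (k - q.+1).
  by move=> /hz[l1 l2]; rewrite slack_plug ?l1 ?l2 //; clear -hip hk; lia.
rewrite (eq_wsum hP); congr (_ + _).
case: (ltnP k i) => hki.
  by rewrite (m1 (fun t => slack _ t k)) a1D //; clear -hki hip; lia.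
case: (leqP k (i + q.+1)) => hkj.
  rewrite !wsumD wsum_cst (m1 (fun=> 1)) a1m (m1 (fun t => slack _ t i)).
  rewrite (m2 (fun t => slack _ t (k - i))) a1D; last by clear -hip; lia.
  by rewrite a2D; [ring|clear -hkj; lia].
by rewrite (m1 (fun t => slack _ t (k - q.+1))) a1D //; clear -hk; lia.
Qed.

Lemma eq_carried n w c D D' a : (forall k, (k <= n.+1)%N -> D k = D' k) ->
  carried n w c D a -> carried n w c D' a.
Proof. by move=> h [h1 h2 h3 h4]; split=> // j hj; rewrite -h // h4. Qed.

(** Each point of the polytope is carried by a simplex: exit from the South
    pole through a facet and recurse in its two factors. *)
Lemma slack_region_covered n w c D : {homo w : a b / (a < b)%N >-> a < b} -> 0
  <= c ->
  slack_region n w D c -> exists a, carried n w c D a.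
Proof.
have [m] := ubnP n; elim: m n w c D => // N IH [|n] w c D hn hw hc hD.
  case: hD => D0 D1 _; exists [:: (c, Node Leaf Leaf)]; split.
  - by rewrite /nonneg /= hc.
  - by rewrite wsum_cons wsum_nil; ring.
  - by rewrite inE.
  by move=> [|[|j]] // _; rewrite wsum_cons wsum_nil /= ?D0 ?D1; ring.
have [m [i [j [/andP[m0 mc] hij hE tight]]]] := ray_exit hw hD.
have [p [q [epq eij hip]]] : exists p q, [/\ (p + q = n)%N, (i + q.+1 = j)%N &
  (i <= p)%N].
  by exists (n - (j - i).-1)%N, (j - i).-1; split; lia.
subst n j; set E := fun k => _ in hE.
have [r1 r2] := facet_regions hw hip hE tight.
have he : 0 <= c - m by rewrite subr_ge0.
have [a1 h1] := IH p _ _ _ (ltac:(lia)) (homo_collapse i q.+1 hw) he r1.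
have [|a2 h2] := IH q _ _ _ (ltac:(lia)) _ he r2.
  by move=> a b hab; apply: hw; lia.
have [a ha] := cone_over_facet hip m0 h1 h2; rewrite [m + _]addrC subrK in ha.
exists a; apply: eq_carried ha => k hk; rewrite ltnn.
case: (ltnP k i) => hki; first by rewrite /E; ring.
case: (leqP k (i + q.+1)) => hkj.
  rewrite subnKC // /E.
  ring.
by rewrite ifF; [rewrite subnK /E; [ring|lia]|lia].
Qed.

End Cover.

(** * Convex hulls and vertex coordinates *)

Section Geometry.
Variable R : realType.

Definition vsum (V : lmodType R) (T : Type) (f : T -> V) (a : seq (R * T)) : V :=
  \sum_(z <- a) z.1 *: f z.2.

Lemma vsum_cons (V : lmodType R) (T : Type) (f : T -> V) c x a :
  vsum f ((c, x) :: a) = c *: f x + vsum f a.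
Proof. by rewrite /vsum big_cons. Qed.

Lemma vsum_nil (V : lmodType R) (T : Type) (f : T -> V) : vsum f [::] = 0.
Proof. by rewrite /vsum big_nil. Qed.

Lemma convex_comb (V : lmodType R) (A : set V) (x y : V) (k : R) :
  @convex_set R V A -> A x -> A y -> 0 <= k <= 1 -> A (k *: x + (1 - k) *: y).
Proof.
move=> cA Ax Ay /andP[k0 k1].
by have := cA x y (Itv01 k0 k1) (mem_set Ax) (mem_set Ay) => /set_mem.
Qed.

Lemma hull_convex (V : lmodType R) (A : set V) : @convex_set R V (hull A).
Proof.
move=> x y k /set_mem hx /set_mem hy; apply/mem_set => B [cB AB].
by apply/set_mem/cB; apply/mem_set; [apply: hx|apply: hy].
Qed.

Lemma nonneg_mass0 (V : lmodType R) (T : Type) (f : T -> V) a :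
  nonneg a -> wsum a (fun=> 1) = 0 -> vsum f a = 0.
Proof.
elim: a => [|[c x] a IH]; first by rewrite vsum_nil.
case/andP => /= hc ha; rewrite !wsum_cons vsum_cons mulr1 => h.
have ha0 := wsum_ge0 ha (fun=> ler01).
rewrite IH //; last lra.
by rewrite (_ : c = 0) ?scale0r ?addr0 //; lra.
Qed.

(** Normalizing by the mass c makes the induction on the list go through. *)
Lemma vsum_in_convex (V : lmodType R) (T : Type) (f : T -> V) (A : set V) a c :
  @convex_set R V A -> nonneg a -> wsum a (fun=> 1) = c -> 0 < c ->
  (forall z, List.In z a -> A (f z.2)) -> A (c^-1 *: vsum f a).
Proof.
move=> cA; elim: a c => [|[d x] a IH] c.
  by rewrite wsum_nil => _ <-; rewrite ltxx.
case/andP => /= hd ha; rewrite wsum_cons mulr1 => hm c0 hA.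
have ma := wsum_ge0 ha (fun=> ler01).
have [m0|m0] := eqVneq (wsum a (fun=> 1)) 0.
  rewrite vsum_cons (nonneg_mass0 _ ha m0) addr0.
  have -> : d = c by move: hm; rewrite m0; lra.
  rewrite scalerA mulVf ?gt_eqF // scale1r.
  by apply: (hA (d, x)); left.
have mp : 0 < wsum a (fun=> 1) by rewrite lt_def m0.
have hI := IH _ ha erefl mp (fun z hz => hA z (or_intror hz)).
have hx : A (f x) by apply: (hA (d, x)); left.
have hk : 0 <= d / c <= 1.
  by rewrite divr_ge0 ?(ltW c0) // ler_pdivrMr // mul1r -hm lerDl.
have := convex_comb cA hx hI hk; rewrite vsum_cons scalerDr !scalerA.
rewrite [c^-1 * d]mulrC; congr (A (_ + _ *: _)).
rewrite (_ : 1 - d / c = wsum a (fun=> 1) / c); last first.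
  by rewrite -hm -[X in X - _](@divff _ (d + wsum a (fun=> 1))) ?hm ?gt_eqF //
    -mulrBl -hm addrC addKr.
by rewrite mulrAC divff // mul1r.
Qed.

Lemma vsum_scale0 (V : lmodType R) (T : Type) (f : T -> V) (s : seq T) :
  vsum f [seq (0, t) | t <- s] = 0.
Proof. by rewrite /vsum big_map big1 // => t _; rewrite scale0r. Qed.

Lemma wsum_scale0 (T : Type) (F : T -> R) (s : seq T) :
  wsum [seq (0, t) | t <- s] F = 0.
Proof. by rewrite /wsum big_map big1 // => t _; rewrite mul0r. Qed.

Lemma combine_weights (V : lmodType R) (T : Type) (f : T -> V) (k : R) a b :
  0 <= k <= 1 -> map snd a = map snd b -> nonneg a -> nonneg b ->
  exists c, [/\ map snd c = map snd a, nonneg c,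
    wsum c (fun=> 1) = k * wsum a (fun=> 1) + (1 - k) * wsum b (fun=> 1) &
    vsum f c = k *: vsum f a + (1 - k) *: vsum f b].
Proof.
move=> /andP[k0 k1]; elim: a b => [|[c x] a IH] [|[d y] b] //=.
  by exists [::]; split; rewrite // ?wsum_nil ?vsum_nil ?scaler0 ?mulr0 ?addr0.
move=> [-> eab] /andP[/= hc ha] /andP[/= hd hb].
have [z [z1 z2 z3 z4]] := IH b eab ha hb.
exists ((k * c + (1 - k) * d, y) :: z); split.
- by rewrite /= z1.
- by rewrite /nonneg /= -/(nonneg z) z2 andbT addr_ge0 // mulr_ge0 // subr_ge0.
- by rewrite !wsum_cons z3; ring.
- rewrite !vsum_cons z4; move: (1 - k) => l;
    rewrite !scalerDr !scalerDl !scalerA -!addrA; congr (_ + _).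
  by rewrite addrCA.
Qed.

Lemma hull_seqP (V : lmodType R) (T : Type) (f : T -> V) (s : seq T) x :
  hull [set` map f s] x <-> exists a : seq (R * T),
    [/\ map snd a = s, nonneg a, wsum a (fun=> 1) = 1 & x = vsum f a].
Proof.
split; last first.
  case=> a [ea ha ma ->]; rewrite -[vsum f a]scale1r -[1]invr1.
  apply: vsum_in_convex => //; first exact: hull_convex.
  move=> z hz; apply: sub_gen_smallest; rewrite /= -ea.
  elim: (a) hz => //= y b IH [->|/IH]; first exact: mem_head.
  by rewrite inE => ->; rewrite orbT.
move: x; apply: smallest_sub.
  move=> x y k /set_mem[a [ea ha ma ->]] /set_mem[b [eb hb mb ->]]; apply/mem_set.
  have hk : 0 <= k%:num <= 1 by rewrite ge0 le1.
  have [c [c1 c2 c3 c4]] := combine_weights f hk (etrans ea (esym eb)) ha hb.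
  exists c; split=> //; first by rewrite c1.
  by rewrite c3 ma mb; ring.
move=> x /=; elim: s => //= t s IH; rewrite inE => /predU1P[->|/IH[a [ea ha ma
  ->]]].
  exists ((1, t) :: [seq (0, u) | u <- s]); split.
  - by rewrite /= -map_comp map_id.
  - by rewrite /nonneg /= ler01; elim: (s) => //= u s' ->; rewrite lexx.
  - by rewrite wsum_cons wsum_scale0 mulr1 addr0.
  - by rewrite vsum_cons vsum_scale0 scale1r addr0.
exists ((0, t) :: a); split.
- by rewrite /= ea.
- by rewrite /nonneg /= lexx.
- by rewrite wsum_cons mul0r add0r.
- by rewrite vsum_cons scale0r add0r.
Qed.

Lemma size_weights t : size (weights t) = nodes t.
Proof. by elim: t => //= l IHl r IHr; rewrite size_cat /= IHl IHr; lia. Qed.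

(** For unit leaf weights, the first j coordinates of the left comb are 1, 2,
    ..., j. *)
Lemma weights_slack (w : nat -> R) t j : (forall k, w k = w 0%N + k%:R) ->
  (j < nodes t)%N ->
  (nth 0%N (weights t) j)%:R = slack w t j.+1 - slack w t j + j.+1%:R.
Proof.
elim: t w j => //= l IHl r IHr w j hw hj; rewrite nth_cat size_weights.
have ll := leaves_nodes l; have lr := leaves_nodes r.
have hwr k : w (leaves l + k)%N = w (leaves l + 0)%N + k%:R.
  by rewrite [LHS]hw [in RHS]hw addn0 natrD; ring.
case: (ltngtP j (nodes l)) => hjl.
- rewrite (_ : (j.+1 < _)%N); last lia.
  by rewrite (_ : (j < _)%N); [apply: IHl|lia].
- rewrite (_ : (j.+1 < leaves l)%N = false); last lia.
  rewrite (_ : (j < leaves l)%N = false); last lia.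
  have -> : (j - nodes l = (j - leaves l).+1)%N by lia.
  have -> : (j.+1 - leaves l = (j - leaves l).+1)%N by lia.
  rewrite /= (IHr _ _ hwr); last lia.
  rewrite (hw j.+1) (hw j.+2) (hw (leaves l)) (hw (leaves l + _)%N).
  have -> : j.+1 = (leaves l + (j - leaves l).+1)%N by lia.
  rewrite -[(_ + _).+1]addn1 !natrD; ring.
rewrite hjl subnn /= (_ : (nodes l < _)%N); last lia.
rewrite -ll ltnn subnn slack_first.
rewrite [slack w l _](_ : _ = 0); last by rewrite (_ : nodes l = (leaves l).-1)
  ?slack_last //; lia.
rewrite (hw (leaves l)) (hw (leaves l + _)%N) (hw (leaves l).+1) natrM natrD.
rewrite -[(leaves l).+1]addn1 natrD; ring.
Qed.

End Geometry.

(** * Simplices in the realization *)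

Section Triangulation.
Variable R : realType.

Definition natw (k : nat) : R := k%:R.

Lemma natw_incr : {homo natw : a b / (a < b)%N >-> a < b}.
Proof. by move=> a b; rewrite ltr_nat. Qed.

(** The slack coordinates of a point of the realization, from its partial
    sums. *)
Definition row_slack n (x : 'rV[R]_n.+1) (j : nat) : R :=
  \sum_(k < n.+1 | (k < j)%N) (x 0 k - k.+1%:R).

Lemma row_slackS n (x : 'rV[R]_n.+1) (k : 'I_n.+1) :
  row_slack x k.+1 = row_slack x k + (x 0 k - k.+1%:R).
Proof.
rewrite /row_slack (bigD1 k) //= addrC; congr (_ + _).
by apply: eq_bigl => i; rewrite -val_eqE /= ltnS ltn_neqAle andbC.
Qed.

Lemma row_slack0 n (x : 'rV[R]_n.+1) : row_slack x 0 = 0.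
Proof. by rewrite /row_slack big_pred0. Qed.

Lemma row_slack_loday n t j : nodes t = n.+1 -> (j <= n.+1)%N ->
  row_slack (loday R n.+1 t) j = slack natw t j.
Proof.
move=> ht; elim: j => [|j IH] hj; first by rewrite row_slack0 slack_first.
rewrite (row_slackS _ (Ordinal hj)) /= IH ?mxE /=; last lia.
rewrite (@weights_slack R natw) ?ht //; first by ring.
by move=> k; rewrite /natw add0r.
Qed.

Lemma row_slack_inj n (x y : 'rV[R]_n.+1) :
  (forall j, (j <= n.+1)%N -> row_slack x j = row_slack y j) -> x = y.
Proof.
move=> h; apply/rowP => k; have hk := ltn_ord k.
have := row_slackS x k; have := row_slackS y k.
rewrite !h; [|lia|lia]; lra.
Qed.

Lemma row_slack_vsum n (a : seq (R * bintree)) j :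
  (forall t, t \in map snd a -> nodes t = n.+1) -> (j <= n.+1)%N ->
  wsum a (fun=> 1) = 1 ->
  row_slack (vsum (loday R n.+1) a) j = wsum a (slack natw ^~ j).
Proof.
move=> ha hj ma.
rewrite -(eq_wsum (F := fun t => row_slack (loday R n.+1 t) j)); last first.
  by move=> t ht /=; rewrite row_slack_loday ?ha.
(* The correction term makes the identity true for measures of any mass, which
   the induction needs. *)
transitivity (row_slack (vsum (loday R n.+1) a) j +
   (1 - wsum a (fun=> 1)) * \sum_(k < n.+1 | (k < j)%N) k.+1%:R).
  by rewrite ma subrr mul0r addr0.
elim: (a) => [|[c t] b IH].
  rewrite /row_slack !wsum_nil vsum_nil mulr_sumr subr0.
  rewrite -big_split /=; apply: big1 => k _; rewrite mxE; ring.
rewrite !wsum_cons vsum_cons -IH /row_slack !mulr_sumr -!big_split /=.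
by apply: eq_bigr => k _; rewrite !mxE; ring.
Qed.

Lemma slack_region_loday n t : nodes t = n.+1 ->
  slack_region n natw (row_slack (loday R n.+1 t)) 1.
Proof.
move=> ht; have lt : leaves t = n.+2 by rewrite leaves_nodes ht.
split; first exact: row_slack0.
  by rewrite row_slack_loday // (_ : n.+1 = (leaves t).-1) ?slack_last ?lt.
move=> i j hij; rewrite !row_slack_loday //; try lia.
have := @gap_ge0 R natw natw_incr t i j; rewrite lt => /(_ (ltac:(lia))).
rewrite /gap; lra.
Qed.

Lemma row_slack_conv n (x y : 'rV[R]_n.+1) (k : R) j :
  row_slack (k *: x + (1 - k) *: y) j = k * row_slack x j + (1 - k) * row_slack y j.
Proof.
rewrite /row_slack !mulr_sumr -big_split /=; apply: eq_bigr => i _.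
by rewrite !mxE; ring.
Qed.

Lemma associahedron_region n x : associahedron R n x ->
  slack_region n natw (row_slack x) 1.
Proof.
move: x; apply: smallest_sub => [x y k /set_mem[x0 x1 hx] /set_mem[y0 y1 hy]|].
  apply/mem_set; split=> [||i j hij]; rewrite ?row_slack_conv.
  - by rewrite x0 y0 !mulr0 addr0.
  - by rewrite x1 y1 !mulr0 addr0.
  have hk0 : 0 <= k%:num by []. have hk1 : 0 <= 1 - k%:num by rewrite subr_ge0.
  have := ler_wpM2l hk0 (hx i j hij); have := ler_wpM2l hk1 (hy i j hij); lra.
by move=> _ [t /eqP ht <-]; apply: slack_region_loday.
Qed.

Lemma nodes_simplex n (s : seq bintree) t : s \in simplices n -> t \in s ->
  nodes t = n.+1.
Proof. by move=> /flag_simplices[h _] /(flag_all h)[]. Qed.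

Lemma associahedron_cover n x : associahedron R n x ->
  exists2 s, s \in simplices n & hull [set` map (loday R n.+1) s] x.
Proof.
move=> /associahedron_region /(slack_region_covered natw_incr ler01)[a [a0 a1
  aS aD]].
exists (map snd a) => //; apply/hull_seqP; exists a; split=> //.
apply: row_slack_inj => j hj; rewrite row_slack_vsum ?aD //.
by move=> t; apply: nodes_simplex.
Qed.

Lemma simplex_rigid n (s s' : seq bintree) a b : s \in simplices n -> s' \in
  simplices n ->
  map snd a = s -> map snd b = s' -> nonneg a -> nonneg b ->
  wsum a (fun=> 1) = 1 -> wsum b (fun=> 1) = 1 ->
  vsum (loday R n.+1) a = vsum (loday R n.+1) b -> forall F, wsum a F = wsum b F.
Proof.
move=> hs hs' ea eb ha hb ma mb e.
have [fs _] := flag_simplices hs; have [fs' _] := flag_simplices hs'.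
apply: (flag_rigid natw_incr (or_intror fs) (or_intror fs') ea eb ha hb).
split=> [|j hj]; first by rewrite ma mb.
have na t : t \in map snd a -> nodes t = n.+1 by rewrite ea; apply: nodes_simplex.
have nb t : t \in map snd b -> nodes t = n.+1 by rewrite eb; apply: nodes_simplex.
by rewrite -!(row_slack_vsum _ hj) ?e.
Qed.

(** Compare the unit mass at t with a combination of the vertices of the other
    simplex. *)
Lemma vertex_in_hull n (s s' : seq bintree) t : s \in simplices n -> s' \in
  simplices n ->
  t \in s -> hull [set` map (loday R n.+1) s'] (loday R n.+1 t) -> t \in s'.
Proof.
move=> hs hs' ts /hull_seqP[b [eb hb mb vb]].
pose a : seq (R * bintree) := [seq ((u == t)%:R, u) | u <- s].
have us : uniq s by have [/flag_uniq] := flag_simplices hs.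
have ea : map snd a = s by rewrite -map_comp map_id.
have hF F : wsum a F = F t.
  rewrite /wsum big_map (bigD1_seq t) //= eqxx mul1r big1 ?addr0 // => u /negbTE ->.
  by rewrite mul0r.
have va : vsum (loday R n.+1) a = loday R n.+1 t.
  rewrite /vsum big_map (bigD1_seq t) //= eqxx scale1r big1 ?addr0 // => u
    /negbTE ->.
  by rewrite scale0r.
have ha : nonneg a by rewrite /nonneg all_map; apply/allP => u _ /=.
have := simplex_rigid hs hs' ea eb ha hb (hF _) mb (etrans va vb).
move=> /(_ (fun u => (u \notin s')%:R)); rewrite hF (eq_wsum (G := fun=> 0)).
  rewrite /wsum big1 => [|z _]; last by rewrite mulr0.
  by case: (t \in s') => //= /eqP; rewrite oner_eq0.
by move=> u; rewrite eb => ->.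
Qed.

Lemma simplices_meet n (s s' : seq bintree) : s \in simplices n -> s' \in
  simplices n ->
  hull [set` map (loday R n.+1) s] `&` hull [set` map (loday R n.+1) s'] =
  hull [set` map (loday R n.+1) [seq t <- s | t \in s']].
Proof.
move=> hs hs'; apply/seteqP; split=> x; last first.
  move=> hx; split; apply: (sub_smallest2r _ _ hx); try exact: hull_convex.
    by move=> y /= /mapP[t]; rewrite mem_filter => /andP[_ ht] ->; apply: map_f.
  by move=> y /= /mapP[t]; rewrite mem_filter => /andP[ht _] ->; apply: map_f.
case=> /hull_seqP[a [ea ha ma va]] /hull_seqP[b [eb hb mb vb]].
have := simplex_rigid hs hs' ea eb ha hb ma mb (etrans (esym va) vb).
move=> /(_ (fun u => (u \notin s')%:R)); rewrite [RHS](eq_wsum (G := fun=> 0));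
  last first.
  by move=> u; rewrite eb => ->.
rewrite [RHS]big1 => [|z _]; last by rewrite mulr0.
move=> h0; pose a' := [seq z <- a | z.2 \in s'].
have hz z : z \in a -> z.2 \notin s' -> z.1 = 0.
  move=> za zs; apply/eqP; move: h0 => /eqP; rewrite /wsum big_seq psumr_eq0.
    by move=> /allP /(_ _ za); rewrite za zs /= mulr1.
  by move=> y /(allP ha) hy; rewrite mulr_ge0.
apply/hull_seqP; exists a'; split.
- by rewrite -ea filter_map.
- by apply/allP => z; rewrite mem_filter => /andP[_]; move: z; apply/allP.
- rewrite -[RHS]ma /wsum big_filter big_mkcond big_seq [RHS]big_seq;
    apply: eq_bigr => z za.
  by case: ifPn => // h; rewrite (hz z za h) mul0r.
- rewrite va /vsum big_filter [RHS]big_mkcond big_seq [RHS]big_seq;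
    apply: eq_bigr => z za.
  by case: ifPn => // h; rewrite (hz z za h) scale0r.
Qed.

(** Both vertex sets agree, and a chain is ordered by decreasing [rweight]. *)
Lemma hull_simplex_inj n : {in simplices n &, injective
  (fun s => hull [set` map (loday R n.+1) s])}.
Proof.
move=> s s' hs hs' e.
have sub u v : u \in simplices n -> v \in simplices n ->
   hull [set` map (loday R n.+1) u] = hull [set` map (loday R n.+1) v] ->
     {subset u <= v}.
  move=> hu hv euv t tu; apply: (vertex_in_hull hu hv tu); rewrite -euv.
  by apply: sub_gen_smallest => /=; apply: map_f.
have [fs _] := flag_simplices hs; have [fs' _] := flag_simplices hs'.
apply: (@irr_sorted_eq _ (fun x y => rweight y < rweight x)%N).
- by move=> y x z h1 h2; apply: ltn_trans h2 h1.
- by move=> x; rewrite ltnn.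
- exact/pairwise_sorted/(flag_pairwise fs).
- exact/pairwise_sorted/(flag_pairwise fs').
by move=> t; apply/idP/idP; apply: sub.
Qed.

(** An affine relation between the vertices is the difference of two measures
    with the same barycenter, its positive and negative parts. *)
Lemma simplex_independent n (s : seq bintree) (k : bintree -> R) : s \in
  simplices n ->
  \sum_(t <- s) k t = 0 -> \sum_(t <- s) k t *: loday R n.+1 t = 0 ->
  forall t, t \in s -> k t = 0.
Proof.
move=> hs k0 v0 t ts; have [fs _] := flag_simplices hs.
pose part (h : bintree -> R) : seq (R * bintree) := [seq (Num.max (h u) 0, u) |
  u <- s].
have partE h : map snd (part h) = s by rewrite -map_comp map_id.
have part_ge0 h : nonneg (part h).
  by rewrite /nonneg all_map; apply/allP => u _ /=; rewrite le_max lexx orbT.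
pose p := part k; pose q := part (fun u => - k u).
have maxB (x : R) : Num.max x 0 - Num.max (- x) 0 = x.
  case: (lerP 0 x) => h; first by rewrite max_r ?subr0 // oppr_le0.
  by rewrite max_l ?sub0r ?opprK // oppr_ge0 ltW.
have sumB F : wsum p F - wsum q F = \sum_(u <- s) k u * F u.
  rewrite /wsum !big_map -sumrB; apply: eq_bigr => u _ /=.
  by rewrite -mulrBl maxB.
have sub F : wsum p F = wsum q F.
  apply: (flag_rigid natw_incr (or_intror fs) (or_intror fs) (partE _) (partE _)
            (part_ge0 _) (part_ge0 _)); split=> [|j hj].
    apply/eqP; rewrite -subr_eq0 sumB -[X in _ == X]k0; apply/eqP.
    by apply: eq_bigr => u _; rewrite mulr1.
  apply/eqP; rewrite -subr_eq0 sumB; apply/eqP.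
  rewrite big_seq (eq_bigr (fun u => \sum_(i < n.+1 | (i < j)%N)
      k u * (loday R n.+1 u 0 i - i.+1%:R))); last first.
    by move=> u us; rewrite -(row_slack_loday (nodes_simplex hs us) hj) mulr_sumr.
  rewrite -big_seq exchange_big big1 //= => i _.
  transitivity (\sum_(u <- s) (k u *: loday R n.+1 u) 0 i - i.+1%:R * \sum_(u
    <- s) k u).
    by rewrite mulr_sumr -sumrB; apply: eq_bigr => u _; rewrite [in RHS]mxE; ring.
  by rewrite k0 mulr0 subr0 -summxE v0 mxE.
have := sub (fun u => (u == t)%:R); move/eqP; rewrite -subr_eq0 sumB => /eqP.
rewrite (bigD1_seq t) //=; last exact: flag_uniq fs.
by rewrite eqxx mulr1 big1 ?addr0 // => u /negbTE ->; rewrite mulr0.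
Qed.

Lemma simplex_affinely_independent n (s : seq bintree) : s \in simplices n ->
  affinely_independent [seq loday R n.+1 t | t <- rev s].
Proof.
move=> hs; have [fs _] := flag_simplices hs.
rewrite /affinely_independent; have := flag_uniq fs; rewrite -rev_uniq.
have hr : s = rev (rev s) by rewrite revK.
case E : (rev s) => [|t0 r]; first by rewrite E in hr; have := flag_neq0 fs;
  rewrite hr.
rewrite cons_uniq => /andP[ht0 ur] /=; rewrite -map_comp.
set X := map _ r; have hX : X = in_tuple X by [].
rewrite hX; apply/freeP => c hc i.
pose k u : R := if u == t0 then - \sum_(j < size X) c j else
   \sum_(j < size X | nth Leaf r j == u) c j.
have szX : size X = size r by rewrite size_map.
have sumr (V : lmodType R) (G : bintree -> V) :
    \sum_(u <- r) k u *: G u = \sum_(j < size X) c j *: G (nth Leaf r j).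
  rewrite big_seq (eq_bigr (fun u => \sum_(j < size X)
      (if nth Leaf r j == u then c j *: G u else 0))); last first.
    move=> u hu; rewrite -big_mkcond /k -scaler_suml; case: eqP => // eu.
    by rewrite -eu hu in ht0.
  rewrite -big_seq exchange_big /=; apply: eq_bigr => j _.
  have hj : nth Leaf r j \in r by rewrite mem_nth // -szX.
  rewrite (bigD1_seq (nth Leaf r j)) //= eqxx big1 ?addr0 // => u.
  by rewrite eq_sym => /negbTE ->.
have sums (V : lmodType R) (G : bintree -> V) :
    \sum_(u <- s) k u *: G u = \sum_(j < size X) c j *: (G (nth Leaf r j) - G t0).
  rewrite (perm_big (rev s)); last by rewrite perm_sym perm_rev.
  rewrite E big_cons sumr /k eqxx scaleNr scaler_suml.
  by rewrite /= addrC -sumrB; apply: eq_bigr => j _; rewrite scalerBr.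
have hi : (i < size r)%N by rewrite -szX.
have ns : nth Leaf r i \in s by rewrite hr E mem_rev inE mem_nth ?orbT.
have kc : k (nth Leaf r i) = c i.
  rewrite /k ifF; last by apply/eqP => e; rewrite -e mem_nth in ht0.
  rewrite (big_pred1 i) // => j /=; rewrite nth_uniq ?szX //.
  by rewrite -szX.
apply: etrans (esym kc) _; apply: (simplex_independent hs _ _ ns).
  transitivity (\sum_(u <- s) k u *: (1 : R^o)).
    by apply: eq_bigr => u _; rewrite [_ *: _]mulr1.
  by rewrite sums big1 // => j _; rewrite subrr scaler0.
rewrite sums -[RHS]hc; apply: eq_bigr => j _; congr (_ *: _).
by rewrite (nth_map Leaf) // -szX.
Qed.
End Triangulation.

(** * The recursion in terms of shuffles *)

(** Simplices are listed in decreasing order internally, in increasing order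
    here. *)
Definition triangulation n : set (seq bintree) := [set s | rev s \in simplices n].

Lemma triangulationE n :
  triangulation n = [set rev s | s in [set` simplices n]].
Proof.
apply/seteqP; split=> s /=; first by move=> h; exists (rev s); rewrite ?revK.
by case=> x hx <-; rewrite /triangulation /= revK.
Qed.

(** Decreasing lists and leaves counted from the left on one side, increasing
    lists and leaves counted from the right on the other. *)
Lemma cell_simplexE p q i u v w : (i <= p)%N ->
  u \in simplices p -> v \in simplices q -> w \in words (p + q) p ->
  rev [seq plug z.1 i z.2 | z <- walk w u v] =
  [seq graft x.1 (p.+1 - i) x.2 | x <- walk (rev w) (rev u) (rev v)].
Proof.
move=> hi hu hv; rewrite mem_words => /andP[/eqP sw /eqP cw].
have [fu su] := flag_simplices hu; have [fv sv] := flag_simplices hv.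
have nw : count negb w = q by rewrite count_negb sw cw addKn.
rewrite -map_rev -rev_walk ?cw ?nw //; apply/eq_in_map => z; rewrite mem_rev => hz.
have [] := walk_sub _ _ hz; rewrite ?cw ?nw ?su ?sv //.
move=> /(flag_all fu)[lz _] _.
by rewrite graft_plug leaves_nodes lz //=; [congr plug|]; lia.
Qed.

Lemma walk_nseq_false x (v : seq bintree) q : size v = q.+1 ->
  walk (nseq q false) [:: x] v = [seq (x, y) | y <- v].
Proof.
elim: q v => [|q IH] [|y v] //=; first by case: v.
by case=> /IH ->.
Qed.

Lemma words0 n w : w \in words n 0 -> w = nseq n false.
Proof.
elim: n w => [|n IH] w /=; first by rewrite inE => /eqP.
by move=> /mapP[x /IH -> ->].
Qed.

Lemma rev_nseq (T : Type) n (x : T) : rev (nseq n x) = nseq n x.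
Proof.
by elim: n => // n IH; rewrite -[in LHS]addn1 nseqD rev_cat IH.
Qed.

Lemma triangulation_rec n : (1 <= n)%N ->
  triangulation n = [set rcons s (south_pole n) | s in boundary_simplices
    triangulation n].
Proof.
case: n => // n _.
have hT s : triangulation n.+1 s =
    (rev s \in map (simplex_of n) (simplex_data simplices n)).
  by rewrite /triangulation -simplicesS.
apply/seteqP; split=> s; first rewrite hT.
  case/mapP => -[p [i [u [v w]]]]; rewrite mem_simplex_data.
  case/and5P => hp hi hu hv hw es.
  have epq : (p + (n - p) = n)%N by rewrite subnKC.
  have hw' := hw; rewrite -{1}epq in hw'.
  exists (rev [seq plug z.1 i z.2 | z <- walk w u v]); last first.
    by rewrite -[s]revK es rev_cons.
  rewrite (cell_simplexE hi hu hv hw').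
  (* A factor of dimension 0 has one vertex; all steps are in the other one. *)
  case: (posnP p) => [p0|p0].
    left; subst p; move: hi; rewrite leqn0 => /eqP i0; subst i.
    move: hu hv hw; rewrite inE subn0 => /eqP -> hv /words0 ->.
    exists (rev v); first by rewrite /triangulation /= revK.
    have [_ sv] := flag_simplices hv.
    by rewrite rev_nseq walk_nseq_false ?size_rev // -map_comp.
  right; have hrw : rev w \in words (p + (n - p)) p.
    by move: hw'; rewrite !mem_words size_rev count_rev.
  have [theta htheta etheta] := shuffle_word_surj hrw.
  exists p, (n - p)%N, (p.+1 - i)%N, (rev u), (rev v), theta.
  split=> //; try by rewrite /triangulation /= revK.
    by split=> //; lia.
  by rewrite product_simplexE etheta.
case=> x hx <-; rewrite hT rev_rcons; apply/mapP.
case: hx => [[u hu ->]|[p [q [a [u [v [theta [[p1 hpq /andP[a1 ap]] hu hv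
  htheta ->]]]]]]]].
  exists (0%N, (0%N, ([:: Node Leaf Leaf], (rev u, nseq n false)))).
    rewrite mem_simplex_data subn0 hu inE /= mem_words size_nseq eqxx /=.
    by rewrite eqxx count_nseq.
  have [_ su] := flag_simplices hu.
  by rewrite /simplex_of walk_nseq_false // -map_comp map_rev.
have {}hpq : (p + q)%N = n := hpq.
subst n.
exists (p, (p.+1 - a, (rev u, (rev v, rev (shuffle_word theta)))))%N.
  rewrite mem_simplex_data leq_addr addKn hu hv.
  have := shuffle_word_in theta; rewrite !mem_words size_rev count_rev => ->.
  by rewrite andbT; lia.
have hw : rev (shuffle_word theta) \in words (p + q) p.
  by have := shuffle_word_in theta; rewrite !mem_words size_rev count_rev.
have -> : [seq graft x.1 a x.2 | x <- product_simplex theta u v] =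
    rev [seq plug z.1 (p.+1 - a) z.2 | z <- walk (rev (shuffle_word theta))
      (rev u) (rev v)].
  rewrite (@cell_simplexE p q) //; last lia.
  by rewrite !revK product_simplexE; apply: eq_map => z; congr graft; lia.
by rewrite revK.
Qed.

Lemma triangulation_tamari n s : triangulation n s -> tamari_compatible s.
Proof.
move=> /flag_simplices[fs _] i j /andP[hij hj].
have fl J x a b : flag n.+1 J x -> (a < b < size x)%N ->
    tamari_lt (nth Leaf x b) (nth Leaf x a).
  move=> fx; elim: fx a b => {J x} [J v _|J v k x h1 h2 h3 IH] a b hab.
    by move: hab => /=; lia.
  case: a b hab => [|a] [|b] //= hab.
    by apply: (flag_lt (flagS h1 h2 h3)); rewrite mem_nth.
  exact: IH.
rewrite -[s]revK; move: fs hj; rewrite -(size_rev s); move: (rev s) => r fr hj.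
by rewrite !nth_rev //; [apply: fl fr _; lia|lia].
Qed.

Theorem theorem2p2 (R : realType) :
  exists T : nat -> set (seq bintree),
    (forall n : nat,
       let D := [set [seq loday R n.+1 t | t <- s] | s in T n] in
       [/\ forall s, T n s -> all (Y n.+1) s,
           is_triangulation n (associahedron R n) D,
           [set hull [set` s] | s in D] #= `I_(n.+1 ^ n.-1)%N &
           forall s, T n s -> tamari_compatible s]) /\
    (forall n : nat, (1 <= n)%N ->
       T n = [set rcons s (south_pole n) | s in boundary_simplices T n]).
Proof.
exists triangulation; split; last exact: triangulation_rec.
move=> n D.
have hrev s : [set` [seq loday R n.+1 t | t <- rev s]] = [set` [seq loday R
  n.+1 t | t <- s]].
  by apply/seteqP; split=> x /=; rewrite map_rev mem_rev.
have DE : D = [set [seq loday R n.+1 t | t <- rev s] | s in [set` simplices n]].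
  by rewrite /D triangulationE image_comp.
split.
- move=> s hs; apply/allP => t ht; apply/eqP.
  by apply: (nodes_simplex hs); rewrite mem_rev.
- split.
  + by rewrite DE; apply/finite_image/finite_seq.
  + rewrite DE => _ [s hs <-]; split; last exact: simplex_affinely_independent.
    by rewrite size_map size_rev; have [] := flag_simplices hs.
  + apply/seteqP; split=> x.
      rewrite DE => -[_ [s hs <-]]; rewrite hrev; apply: sub_smallest2r.
        exact: hull_convex.
      move=> _ /mapP[t ht ->]; exists t => //=.
      exact/eqP/(nodes_simplex hs ht).
    move=> /associahedron_cover[s hs hx]; exists [seq loday R n.+1 t | t <- rev s].
      by rewrite DE; exists s.
    by rewrite /= hrev.
  + rewrite DE => _ _ [s hs <-] [s' hs' <-].
    exists [seq loday R n.+1 t | t <- s & t \in s']; split.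
    * by move=> x /mapP[t]; rewrite mem_filter => /andP[_ ht] ->;
        rewrite map_f ?mem_rev.
    * by move=> x /mapP[t]; rewrite mem_filter => /andP[ht _] ->;
        rewrite map_f ?mem_rev.
    * by rewrite !hrev simplices_meet.
- pose h s := hull [set` [seq loday R n.+1 t | t <- s]].
  have -> : [set hull [set` s] | s in D] =
      (fun k => h (nth [::] (simplices n) k)) @` `I_(n.+1 ^ n.-1)%N.
    rewrite DE image_comp -size_simplices; apply/seteqP; split=> x /=.
      case=> s hs <-; exists (index s (simplices n)); first by rewrite /= index_mem.
      by rewrite /= nth_index // hrev.
    case=> k hk <-; exists (nth [::] (simplices n) k); first exact: mem_nth.
    by rewrite hrev.
  apply: inj_card_eq => k k' /set_mem hk /set_mem hk' e.
  rewrite -size_simplices /= in hk hk'.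
  apply/eqP; rewrite -(nth_uniq [::] hk hk' (simplices_uniq n)); apply/eqP.
  by apply: (hull_simplex_inj _ _ e); apply: mem_nth.
- exact: triangulation_tamari.
Qed.
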